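(* Let $U\subset\mathbb R^n$ be an open neighborhood of $0$ and $f\in\hat{\mathcal E}(U)$ with $\Gamma_+(f)\neq\emptyset$. Let $\Sigma$ be a simplicial subdivision of the fan $\Sigma_0$ associated with $\Gamma_+(f)$ and $\sigma\in\Sigma^{(n)}$ with skeleton $a^1(\sigma),\dots,a^n(\sigma)\in\mathbb Z_+^n$. Then there exists a $C^\infty$ function $f_\sigma$ on $\pi(\sigma)^{-1}(U)$ with $f_\sigma(0)\ne0$ and $$f(\pi(\sigma)(y))=\Big(\prod_{j=1}^ny_j^{l(a^j(\sigma))}\Big)f_\sigma(y)\qquad\text{for }y\in\pi(\sigma)^{-1}(U).$$ Furthermore, if $f$ is nondegenerate over $\mathbb R$ with respect to $\Gamma_+(f)$ and $I\subset\{1,\dots,n\}$ satisfies $\pi(\sigma)(T_I^*(\mathbb R^n))=\{0\}$, then at every point $y\in T_I^*(\mathbb R^n)\cap\pi(\sigma)^{-1}(U)$ with $f_\sigma(y)=0$, the gradient of the restriction of $f_\sigma$ to $T_I^*(\mathbb R^n)$ (i.e. $(\partial f_\sigma/\partial y_j)_{j\notin I}$) does not vanish.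
   Context: $\pi(\sigma):\mathbb R^n\to\mathbb R^n$ is $(x_1,\dots,x_n)=\pi(\sigma)(y)$ with $x_k=\prod_{j=1}^ny_j^{a^j_k(\sigma)}$, where $a^j(\sigma)=(a^j_1(\sigma),\dots,a^j_n(\sigma))$. $T_I^*(\mathbb R^n)=\{y\in\mathbb R^n:y_j=0\iff j\in I\}$. Notation: $H(a,l)=\{x:\langle a,x\rangle=l\}$, $H^+(a,l)=\{x:\langle a,x\rangle\ge l\}$; polyhedron: finite intersection of $H^+(a,l)$, $(a,l)\in\mathbb Z^n\times\mathbb Z$; $(a,l)$ valid for $P$ if $P\subset H^+(a,l)$; faces are $P\cap H(a,l)$ for valid $(a,l)$; $(a,l)$ defines $\gamma$ if $P\cap H(a,l)=\gamma$. Newton polyhedron $\Gamma_+(f)$: convex hull of $\bigcup\{\alpha+\mathbb R_+^n:c_\alpha\ne0\}$. $\gamma$-part and classes: for polyhedron $P\subset\mathbb R_+^n$ with $P+\mathbb R_+^n\subset P$, $\Gamma_+(f)\subset P$, face $\gamma$: $f$ admits the $\gamma$-part on $U$ if for all $x\in U$, $\lim_{t\to0^+}f(t^{a_1}x_1,\dots,t^{a_n}x_n)/t^l$ exists for all valid $(a,l)\in\mathbb Z_+^n\times\mathbb Z_+$ defining $\gamma$ (value $f_\gamma(x)$). $\hat{\mathcal E}[P](U)$: smooth $f$ on $U$ with $\Gamma_+(f)\subset P$ admitting all $\gamma$-parts; $\hat{\mathcal E}(U)=\{f:f\in\hat{\mathcal E}[\Gamma_+(f)](U)\}$. Nondegeneracy: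 for every compact face $\gamma$ of $\Gamma_+(f)$, $f_\gamma=\sum_{\alpha\in\gamma}c_\alpha x^\alpha$ has $\nabla f_\gamma\ne0$ on $U\cap(\mathbb R\setminus\{0\})^n$. Fan: $l(a)=\min\{\langle a,\alpha\rangle:\alpha\in\Gamma_+(f)\}$; for each face $\gamma$, $\gamma^*=\{a\in\mathbb R_+^n:H(a,l(a))\cap\Gamma_+(f)=\gamma\}$; closures of $\gamma^*$ form $\Sigma_0$; a simplicial subdivision $\Sigma$ has the same support $\mathbb R_+^n$, each cone inside a cone of $\Sigma_0$, and each cone's skeleton (primitive integer edge vectors) completable to a basis of $\mathbb Z^n$; $\Sigma^{(n)}$ = its $n$-dimensional cones. *)

(* Defs.v *)
From Stdlib Require Import Reals ZArith List.
From mathcomp Require Import ssreflect ssrfun ssrbool eqtype ssrnat seq fintype bigop.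
Set Implicit Arguments. Unset Strict Implicit. Unset Printing Implicit Defensive.
Open Scope R_scope.

Definition vec (n : nat) := 'I_n -> R.
Definition mindex (n : nat) := 'I_n -> nat.
Definition zero (n : nat) : vec n := fun _ => 0.
Arguments zero n : clear implicits.
Definition natv n (a : mindex n) : vec n := fun i => INR (a i).
Definition Zv n (a : 'I_n -> Z) : vec n := fun i => IZR (a i).
Definition dotR n (a x : vec n) : R := \big[Rplus/0]_(i < n) (a i * x i).

Definition near n (x y : vec n) (d : R) : Prop := forall i, Rabs (y i - x i) < d.
Definition is_open n (V : vec n -> Prop) : Prop :=
  forall x, V x -> exists d, 0 < d /\ forall y, near x y d -> V y.
Definition cont_on n (V : vec n -> Prop) (f : vec n -> R) : Prop :=
  forall x, V x -> forall eps, 0 < eps ->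
    exists d, 0 < d /\ forall y, V y -> near x y d -> Rabs (f y - f x) < eps.
Definition closure n (A : vec n -> Prop) (x : vec n) : Prop :=
  forall eps, 0 < eps -> exists y, A y /\ near x y eps.

Definition upd n (x : vec n) (j : 'I_n) (t : R) : vec n :=
  fun i => if i == j then t else x i.
Definition has_partial n (f : vec n -> R) (j : 'I_n) (x : vec n) (d : R) : Prop :=
  derivable_pt_lim (fun t => f (upd x j t)) (x j) d.
Fixpoint Ck (n k : nat) (V : vec n -> Prop) (f : vec n -> R) {struct k} : Prop :=
  match k with
  | O => cont_on V f
  | S k' => cont_on V f /\
      forall j : 'I_n, exists g : vec n -> R,
        (forall x, V x -> has_partial f j x (g x)) /\ Ck k' V g
  end.
Definition smooth_on n (V : vec n -> Prop) (f : vec n -> R) : Prop :=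
  forall k, Ck k V f.

Inductive iter_partial n (V : vec n -> Prop) :
    list 'I_n -> (vec n -> R) -> (vec n -> R) -> Prop :=
| ip_nil f : iter_partial V nil f f
| ip_cons j js f g h :
    (forall x, V x -> has_partial f j x (g x)) ->
    iter_partial V js g h -> iter_partial V (j :: js) f h.
Definition mlist n (al : mindex n) : list 'I_n :=
  flatten [seq nseq (al j) j | j <- enum 'I_n].
Definition fact_m n (al : mindex n) : R := \big[Rmult/1]_(i < n) INR (fact (al i)).
Definition taylor_coef n (V : vec n -> Prop) (f : vec n -> R) (al : mindex n) (c : R) : Prop :=
  exists h, iter_partial V (mlist al) f h /\ c = h (zero n) / fact_m al.
Definition in_supp n V (f : vec n -> R) (al : mindex n) : Prop :=
  exists c, taylor_coef V f al c /\ c <> 0.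

(** Newton polyhedron: convex hull of the union of al + R_+^n, c_al <> 0 *)
Definition Newton n (V : vec n -> Prop) (f : vec n -> R) (x : vec n) : Prop :=
  exists l : list (R * mindex n * vec n),
    (forall q, In q l -> 0 <= fst (fst q) /\ in_supp V f (snd (fst q)) /\
                         forall i, INR (snd (fst q) i) <= snd q i) /\
    fold_right Rplus 0 (map (fun q => fst (fst q)) l) = 1 /\
    forall i, x i = fold_right Rplus 0 (map (fun q => fst (fst q) * snd q i) l).

Definition valid n (P : vec n -> Prop) (a : 'I_n -> Z) (l : Z) : Prop :=
  forall x, P x -> IZR l <= dotR (Zv a) x.
Definition defines n (P : vec n -> Prop) (a : 'I_n -> Z) (l : Z) (g : vec n -> Prop) : Prop :=
  forall x, g x <-> (P x /\ dotR (Zv a) x = IZR l).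
Definition is_face n (P g : vec n -> Prop) : Prop :=
  exists a l, valid P a l /\ defines P a l g.

Definition tpow n (a : mindex n) (t : R) (x : vec n) : vec n := fun i => t ^ (a i) * x i.
Definition natZ n (a : mindex n) : 'I_n -> Z := fun i => Z.of_nat (a i).
Definition admits_part n (P U : vec n -> Prop) (f : vec n -> R) (g : vec n -> Prop) : Prop :=
  forall (a : mindex n) (l : nat),
    valid P (natZ a) (Z.of_nat l) -> defines P (natZ a) (Z.of_nat l) g ->
    forall x, U x -> exists L,
      limit1_in (fun t => f (tpow a t x) / t ^ l)
                (fun t => 0 < t /\ U (tpow a t x)) L 0.
Definition hatE n (U : vec n -> Prop) (f : vec n -> R) : Prop :=
  smooth_on U f /\
  forall g, is_face (Newton U f) g -> admits_part (Newton U f) U f g.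

Definition bounded n (g : vec n -> Prop) : Prop :=
  exists B, forall x, g x -> forall i, Rabs (x i) <= B.
Definition compact_face n (P g : vec n -> Prop) : Prop :=
  is_face P g /\ (exists x, g x) /\ bounded g.
Definition mono n (al : mindex n) (x : vec n) : R := \big[Rmult/1]_(i < n) (x i ^ al i).
Definition poly_of n (S : list (mindex n * R)) (x : vec n) : R :=
  fold_right Rplus 0 (map (fun p => snd p * mono (fst p) x) S).
(* S lists (al, c_al) for all al in gamma with c_al <> 0, so poly_of S = f_gamma *)
Definition gamma_part_list n (V : vec n -> Prop) f (g : vec n -> Prop) (S : list (mindex n * R)) : Prop :=
  NoDup (map fst S) /\
  (forall p, In p S -> taylor_coef V f (fst p) (snd p) /\ g (natv (fst p))) /\
  (forall al, g (natv al) -> in_supp V f al -> In al (map fst S)).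
Definition grad_nonzero n (h : vec n -> R) (J : 'I_n -> Prop) (x : vec n) : Prop :=
  ~ (forall j, J j -> has_partial h j x 0).
Definition nondegenerate n (U : vec n -> Prop) (f : vec n -> R) : Prop :=
  forall g, compact_face (Newton U f) g ->
  forall S, gamma_part_list U f g S ->
  forall x, U x -> (forall i, x i <> 0) -> grad_nonzero (poly_of S) (fun _ => True) x.

Definition lmin n (P : vec n -> Prop) (a : vec n) (m : R) : Prop :=
  (exists x, P x /\ dotR a x = m) /\ forall x, P x -> m <= dotR a x.
Definition dual_cone n (P g : vec n -> Prop) (a : vec n) : Prop :=
  (forall i, 0 <= a i) /\
  exists m, lmin P a m /\ forall x, (P x /\ dotR a x = m) <-> g x.
Definition in_cone n (S : list (mindex n)) (x : vec n) : Prop :=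
  exists lam : list R, length lam = length S /\ Forall (Rle 0) lam /\
    forall i, x i = fold_right Rplus 0 (map (fun p => fst p * INR (snd p i)) (combine lam S)).
Definition zlin n (B : list ('I_n -> Z)) (k : list Z) (i : 'I_n) : Z :=
  fold_right Z.add 0%Z (map (fun p => (fst p * snd p i)%Z) (combine k B)).
Definition Zbasis n (B : list ('I_n -> Z)) : Prop :=
  length B = n /\
  (forall z : 'I_n -> Z, exists k, length k = n /\ forall i, zlin B k i = z i) /\
  (forall k, length k = n -> (forall i, zlin B k i = 0%Z) -> Forall (eq 0%Z) k).
Definition completable n (S : list (mindex n)) : Prop :=
  exists T, Zbasis (map (@natZ n) S ++ T).
(* Sig: the cones of the subdivision, each given by its skeleton *)
Definition simplicial_subdivision n (P : vec n -> Prop) (Sig : list (mindex n) -> Prop) : Prop :=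
  (forall x, (forall i, 0 <= x i) <-> exists S, Sig S /\ in_cone S x) /\
  (forall S, Sig S -> exists g, is_face P g /\
       forall x, in_cone S x -> closure (dual_cone P g) x) /\
  (forall S, Sig S -> completable S).

Definition pi n (a : 'I_n -> mindex n) (y : vec n) : vec n :=
  fun k => \big[Rmult/1]_(j < n) (y j ^ a j k).
Definition T_I n (I : 'I_n -> bool) (y : vec n) : Prop := forall j, y j = 0 <-> I j.

(* Main.v *)
(**
Let [V] be the preimage of [U] under [pi a].  Approaching a wall [y_j = 0] of [V] amounts to
applying the one-parameter scaling of weight [a^j] to a point of [U], so the existence of the
part of [f] along the face defined by [(a^j, l_j)] says that [f o pi] divided by [y_j^(l_j)]
has a limit at generic points of the wall.  Hadamard's lemma then lets one divide by the
coordinates one at a time, and the quotients are smooth because [int_0^1 t^m h(.., t y_j, ..) dt]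
inherits the differentiability of [h].

The cone lies in the closure of one dual cone, so all the forms [a^j] are minimal at a common
support point [al0], which is the only lattice point where they are since the [a^j] form a basis.
For a set [I] of indices such that [w = sum_(j in I) a^j] is positive, the limit of
[f(t^w x) / t^l] as [t -> 0+] is, by Taylor's formula, the face polynomial cut out by [w]; by the
factorization, at [x = pi a z] it is [prod_j z_j^(l_j)] times [fs] at the projection of [z] to
[z_I = 0].  With [I] everything this gives [fs 0 = c_al0 <> 0].  For the [I] of the theorem, a
critical zero of the restriction of [fs] lifts to a critical point in the torus of the face
polynomial composed with [pi a], hence gives a critical point of the face polynomial itself.
*)
From Stdlib Require Import Reals ZArith List Lra.
From Stdlib Require Import FunctionalExtensionality Classical ClassicalEpsilon.
From mathcomp Require Import ssreflect ssrfun ssrbool eqtype ssrnat seq fintype finfun bigop.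
From mathcomp Require Import Rstruct.
From Coquelicot Require Import Coquelicot.
Require Import Defs.
Set Implicit Arguments. Unset Strict Implicit. Unset Printing Implicit Defensive.
Open Scope R_scope.

Section Sums.

Lemma INR_sum (I : Type) (r : seq I) (P : pred I) (F : I -> nat) :
  INR (\sum_(i <- r | P i) F i)%N = \big[Rplus/0]_(i <- r | P i) INR (F i).
Proof. exact: (big_morph INR plus_INR). Qed.

Lemma fold_right_Rplus (T : Type) (F : T -> R) (r : seq T) :
  fold_right Rplus 0 (map F r) = \big[Rplus/0]_(q <- r) F q.
Proof. by elim: r => [|q r IH] /=; rewrite ?big_nil ?big_cons ?IH. Qed.

Lemma Rsum_ge0 (I : Type) (r : seq I) (P : pred I) (F : I -> R) :
  (forall i : I, P i -> 0 <= F i) -> 0 <= \big[Rplus/0]_(i <- r | P i) F i.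
Proof. by move=> F0; elim/big_ind: _ => //; [lra|exact: Rplus_le_le_0_compat]. Qed.

Lemma Rsum_le (I : Type) (r : seq I) (P : pred I) (F G : I -> R) :
  (forall i : I, P i -> F i <= G i) ->
  \big[Rplus/0]_(i <- r | P i) F i <= \big[Rplus/0]_(i <- r | P i) G i.
Proof.
by move=> FG; elim/big_ind2: _ => //; [lra|move=> x1 x2 y1 y2; exact: Rplus_le_compat].
Qed.

Lemma term_le_Rsum (I : finType) (F : I -> R) (i : I) :
  (forall k, 0 <= F k) -> F i <= \big[Rplus/0]_k F k.
Proof.
move=> F0; rewrite (bigD1 i) //= -[X in X <= _]Rplus_0_r.
by apply: Rplus_le_compat_l; apply: Rsum_ge0.
Qed.

Lemma big_indicator (I : finType) (F : I -> R) (j : I) :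
  \big[Rplus/0]_i ((if i == j then 1 else 0) * F i) = F j.
Proof.
rewrite (bigD1 j) //= eqxx big1 ?Rmult_1_l ?Rplus_0_r // => i /negbTE ->.
by rewrite Rmult_0_l.
Qed.

Lemma Rsum_le_eq (I : finType) (F G : I -> R) : (forall i, F i <= G i) ->
  \big[Rplus/0]_i G i = \big[Rplus/0]_i F i -> forall i, G i = F i.
Proof.
move=> FG eqFG i; have GF0 k : 0 <= G k + -1 * F k by have := FG k; lra.
have := term_le_Rsum i GF0; rewrite big_split -big_distrr eqFG /=.
by have := FG i; lra.
Qed.

Lemma sum_f_R0E (F : nat -> R) N : sum_f_R0 F N = \big[Rplus/0]_(0 <= k < N.+1) F k.
Proof.
elim: N => [|N IH]; first by rewrite big_nat1.
by rewrite big_nat_recr //= -IH.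
Qed.

Lemma convex_comb_gt (T : Type) (r : seq T) (lam v : T -> R) (m : R) :
  (forall q, In q r -> 0 <= lam q) -> (forall q, In q r -> m < v q) ->
  0 < \big[Rplus/0]_(q <- r) lam q ->
  m * \big[Rplus/0]_(q <- r) lam q < \big[Rplus/0]_(q <- r) (lam q * v q).
Proof.
move=> lam0 vm; suff [weak strict] : m * \big[Rplus/0]_(q <- r) lam q <=
    \big[Rplus/0]_(q <- r) (lam q * v q) /\ (0 < \big[Rplus/0]_(q <- r) lam q ->
  m * \big[Rplus/0]_(q <- r) lam q < \big[Rplus/0]_(q <- r) (lam q * v q)) by exact: strict.
elim: r lam0 vm => [|q r IH] lam0 vm; first by rewrite !big_nil; lra.
have lamq := lam0 q (or_introl erefl); have vq := vm q (or_introl erefl).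
have [weak strict] := IH (fun q hq => lam0 q (or_intror hq)) (fun q hq => vm q (or_intror hq)).
rewrite !big_cons; split; first nra.
by case: lamq => [lamq|<-]; [nra|rewrite Rplus_0_l => /strict; lra].
Qed.

End Sums.

Section Lists.

Lemma In_memP (T : eqType) (x : T) (s : seq T) : reflect (In x s) (x \in s).
Proof.
elim: s => [|y s IH] /=; first exact: ReflectF.
rewrite in_cons; apply: (iffP orP) => [[/eqP ->|/IH]|[->|/IH]]; auto.
Qed.

Lemma uniq_NoDup (T : eqType) (s : seq T) : uniq s -> NoDup s.
Proof.
elim: s => [|y s IH] /=; first by move=> _; exact: NoDup_nil.
by move=> /andP [/In_memP ys us]; apply: NoDup_cons; [exact: ys|exact: IH].
Qed.

Lemma combine_map (T A B : Type) (u : T -> A) (v : T -> B) (s : seq T) :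
  combine (map u s) (map v s) = [seq (u q, v q) | q <- s].
Proof. by elim: s => [|q s IH] //=; rewrite IH. Qed.

End Lists.

Section Filters.
Context {T : Type} {F : (T -> Prop) -> Prop} {FF : Filter F}.

Lemma filter_forall_ord n (P : 'I_n -> T -> Prop) :
  (forall i, F (P i)) -> F (fun x => forall i, P i x).
Proof.
move=> FP; suff: F (fun x => forall i, i \in enum 'I_n -> P i x).
  by apply: filter_imp => x Px i; apply: Px; rewrite mem_enum.
elim: (enum 'I_n) => [|j s IH]; first exact: filter_forall.
apply: filter_imp (filter_and _ _ (FP j) IH) => x [Pj Ps] i.
by rewrite in_cons => /orP [/eqP -> //|]; apply: Ps.
Qed.

Lemma filterlim_Rplus (f g : T -> R) (a b : R) :
  filterlim f F (locally a) -> filterlim g F (locally b) ->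
  filterlim (fun t => f t + g t) F (locally (a + b)).
Proof. by move=> fa gb; apply: filterlim_comp_2 fa gb _; apply: filterlim_plus. Qed.

Lemma filterlim_Rmult (f g : T -> R) (a b : R) :
  filterlim f F (locally a) -> filterlim g F (locally b) ->
  filterlim (fun t => f t * g t) F (locally (a * b)).
Proof. by move=> fa gb; apply: filterlim_comp_2 fa gb _; apply: filterlim_mult. Qed.

Lemma filterlim_Rsum (I : Type) (r : seq I) (f : I -> T -> R) (a : I -> R) :
  (forall i, filterlim (f i) F (locally (a i))) ->
  filterlim (fun t => \big[Rplus/0]_(i <- r) f i t) F
    (locally (\big[Rplus/0]_(i <- r) a i)).
Proof.
move=> fa; elim: r => [|i r IH].
  rewrite big_nil; apply: filterlim_ext (filterlim_const 0) => t.
  by rewrite big_nil.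
rewrite big_cons; apply: filterlim_ext (filterlim_Rplus (fa i) IH) => t.
by rewrite big_cons.
Qed.

Lemma filterlim_squeeze0 (f g : T -> R) :
  F (fun t => Rabs (f t) <= g t) -> filterlim g F (locally 0) -> filterlim f F (locally 0).
Proof.
move=> fg /filterlim_locally g0; apply/filterlim_locally => eps.
apply: filter_imp (filter_and _ _ fg (g0 eps)) => t [ft gt].
have {}gt : Rabs (g t - 0) < eps := gt.
by change (Rabs (f t - 0) < eps); move: ft gt; split_Rabs; lra.
Qed.

Lemma filterlim_vec n (u : T -> vec n) (x : vec n) :
  (forall i, filterlim (u^~ i) F (locally (x i))) -> filterlim u F (locally x).
Proof.
move=> ux; apply/filterlim_locally => eps; apply: filter_forall_ord => i.
by have /filterlim_locally := ux i; apply.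
Qed.

Lemma filterlim_coord n (u : T -> vec n) (x : vec n) i :
  filterlim u F (locally x) -> filterlim (u^~ i) F (locally (x i)).
Proof.
move=> ux; apply/filterlim_locally => eps.
have /filterlim_locally/(_ eps) uxe := ux.
by apply: filter_imp uxe => t; apply.
Qed.

Lemma filterlim_upd n (u : T -> vec n) (x : vec n) (v : T -> R) (c : R) j :
  filterlim u F (locally x) -> filterlim v F (locally c) ->
  filterlim (fun t => upd (u t) j (v t)) F (locally (upd x j c)).
Proof.
move=> ux vc; apply: filterlim_vec => i; rewrite /upd.
by case: eqP => _ //; apply: filterlim_coord.
Qed.

End Filters.

Lemma filterlim_at_right (T : UniformSpace) (f : R -> T) (a : R) :
  continuous f a -> filterlim f (at_right a) (locally (f a)).
Proof. move=> cf; apply: filterlim_filter_le_1 cf; exact: filter_le_within. Qed.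

Lemma filterlim_pow_at_right0 k : filterlim (fun t => t ^ k.+1) (at_right 0) (locally 0).
Proof.
rewrite -[X in locally X](pow_i k.+1 (Nat.lt_0_succ k)).
apply: (filterlim_at_right (f := fun t => t ^ k.+1)).
by apply: ex_derive_continuous; auto_derive.
Qed.

Lemma filterlim_scale_at_right0 (c : R) : 0 < c ->
  filterlim (fun t => t * c) (at_right 0) (at_right 0).
Proof.
move=> c0 P P0.
have cont : filterlim (fun t => t * c) (locally 0) (locally 0).
  rewrite -[X in _ (locally X)](Rmult_0_l c); apply: (ex_derive_continuous (fun t => t * c)).
  by auto_derive.
have Ploc : locally 0 (fun t => 0 < t * c -> P (t * c)) := cont _ P0.
by apply: filter_imp Ploc => t Pt t0; apply: Pt; nra.
Qed.

Lemma at_right_gt (a : R) : at_right a (fun t => a < t).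
Proof. by exists (mkposreal _ Rlt_0_1). Qed.

Lemma limit1_in_at_right (F : R -> R) (D : R -> Prop) (L a : R) :
  limit1_in F D L a -> at_right a D -> filterlim F (at_right a) (locally L).
Proof.
move=> FL Da; apply/filterlim_locally => eps.
have [d [d0 near_a]] := FL eps (cond_pos eps).
have close : at_right a (fun t => Rabs (t - a) < d) by exists (mkposreal d d0).
by apply: filter_imp (filter_and _ _ Da close) => t; exact: near_a.
Qed.

Section Updates.
Variable n : nat.
Implicit Types (x y : vec n) (i j : 'I_n).

Lemma updE x j t : upd x j t j = t.
Proof. by rewrite /upd eqxx. Qed.

Lemma upd_neq x j t i : i != j -> upd x j t i = x i.
Proof. by rewrite /upd => /negbTE ->. Qed.

Lemma upd_id x j : upd x j (x j) = x.
Proof. by apply: functional_extensionality => i; rewrite /upd; case: eqP => // ->. Qed.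

Lemma upd_upd x j s t : upd (upd x j s) j t = upd x j t.
Proof. by apply: functional_extensionality => i; rewrite /upd; case: eqP. Qed.

Lemma upd_comm x i j s t : i != j -> upd (upd x i s) j t = upd (upd x j t) i s.
Proof.
move=> ij; apply: functional_extensionality => k; rewrite /upd.
case: eqP => [->|//]; by rewrite eq_sym (negbTE ij).
Qed.

End Updates.

Section Smoothness.
Variable n : nat.
Implicit Types (x y : vec n) (V W : vec n -> Prop) (f g h : vec n -> R) (i j : 'I_n).

Lemma is_openE V : is_open V <-> open V.
Proof.
split=> oV x /oV [d near_V]; first by exists (mkposreal _ (proj1 near_V)); case: near_V.
by exists d; split; first exact: cond_pos.
Qed.

Lemma is_open_locally V x : is_open V -> V x -> locally x V.
Proof. by move=> /is_openE; apply. Qed.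

Lemma is_open_and V W : is_open V -> is_open W -> is_open (fun x => V x /\ W x).
Proof. by move=> /is_openE oV /is_openE oW; apply/is_openE/open_and. Qed.

Lemma is_open_true : is_open (fun _ : vec n => True).
Proof. exact/is_openE/open_true. Qed.

Lemma is_open_ball x r : is_open (ball x r).
Proof.
apply/is_openE => y xy; apply: filter_forall_ord => i.
have d0 : 0 < r - Rabs (y i - x i) by have : Rabs (y i - x i) < r := xy i; lra.
exists (mkposreal _ d0) => z yz.
have zi : Rabs (z i - y i) < r - Rabs (y i - x i) := yz i.
change (Rabs (z i - x i) < r); split_Rabs; lra.
Qed.

Lemma is_open_subset_ball V x : is_open V -> V x ->
  exists r, 0 < r /\ forall y, ball x r y -> V y.
Proof. by move=> oV /oV. Qed.

Lemma continuous_upd x j t : continuous (upd x j) t.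
Proof.
change (continuous (fun s => upd x j s) t).
by apply: filterlim_upd; [exact: filterlim_const|exact: filterlim_id].
Qed.

Lemma locally_upd x j (P : vec n -> Prop) :
  locally x P -> locally (x j) (fun t => P (upd x j t)).
Proof. by rewrite -{1}(upd_id x j); apply: continuous_upd. Qed.

Lemma at_right_upd x j (P : vec n -> Prop) :
  locally x P -> at_right (x j) (fun t => x j < t /\ P (upd x j t)).
Proof. by move=> /(locally_upd j) Px; apply: filter_imp Px => t Pt xt. Qed.

Lemma continuous_coord i x : continuous (fun y : vec n => y i) x.
Proof. exact: (filterlim_coord (filterlim_id _ _)). Qed.

Lemma cont_onE V f : cont_on V f <-> continuous_on V f.
Proof.
split=> cf x Vx.
- apply/filterlim_locally => eps; have [d [d0 near_x]] := cf x Vx eps (cond_pos eps).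
  by exists (mkposreal _ d0) => y xy Vy; apply: near_x.
- move=> eps e0; have /filterlim_locally/(_ (mkposreal _ e0)) [d near_x] := cf x Vx.
  by exists d; split; [exact: cond_pos|move=> y Vy xy; exact: near_x].
Qed.

Lemma cont_on_continuous V f x : is_open V -> cont_on V f -> V x -> continuous f x.
Proof.
move=> oV /cont_onE cf Vx; apply: continuous_continuous_on cf.
exact: is_open_locally.
Qed.

Lemma cont_on_sub V W f : (forall x, W x -> V x) -> cont_on V f -> cont_on W f.
Proof. by move=> WV /cont_onE cf; apply/cont_onE/(continuous_on_subset V). Qed.

Lemma cont_on_ext V f g : (forall x, V x -> f x = g x) -> cont_on V f -> cont_on V g.
Proof. by move=> fg /cont_onE cf; apply/cont_onE/(continuous_on_ext _ _ _ fg). Qed.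

Lemma cont_on_locally V f :
  (forall x, V x -> exists W, is_open W /\ W x /\ cont_on W f) -> cont_on V f.
Proof.
move=> locf; apply/cont_onE/continuous_on_forall => x /locf [W [oW [Wx cf]]].
exact: cont_on_continuous cf Wx.
Qed.

Lemma cont_on_const V c : cont_on V (fun _ => c).
Proof. by apply/cont_onE => x _; exact: filterlim_const. Qed.

Lemma cont_on_coord V i : cont_on V (fun x => x i).
Proof. by apply/cont_onE/continuous_on_forall => x _; exact: continuous_coord. Qed.

Lemma cont_on_plus V f g : cont_on V f -> cont_on V g -> cont_on V (fun x => f x + g x).
Proof.
move=> /cont_onE cf /cont_onE cg; apply/cont_onE => x Vx.
by apply: filterlim_Rplus; [apply: cf|apply: cg].
Qed.

Lemma cont_on_mult V f g : cont_on V f -> cont_on V g -> cont_on V (fun x => f x * g x).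
Proof.
move=> /cont_onE cf /cont_onE cg; apply/cont_onE => x Vx.
by apply: filterlim_Rmult; [apply: cf|apply: cg].
Qed.

Definition pd f j x : R := Derive (fun t => f (upd x j t)) (x j).

Lemma has_partialE f j x d :
  has_partial f j x d <-> is_derive (fun t => f (upd x j t)) (x j) d.
Proof. by rewrite is_derive_Reals. Qed.

Lemma has_partial_unique f j x d : has_partial f j x d -> pd f j x = d.
Proof. by move/has_partialE/is_derive_unique. Qed.

Lemma has_partial_pd f j x d : has_partial f j x d -> has_partial f j x (pd f j x).
Proof. by move=> Df; rewrite (has_partial_unique Df). Qed.

Lemma has_partial_ext_loc f g j x d : locally x (fun y => f y = g y) ->
  has_partial f j x d -> has_partial g j x d.
Proof.
move=> fg /has_partialE Df; apply/has_partialE.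
apply: is_derive_ext_loc Df; exact: (locally_upd j fg).
Qed.

Lemma is_derive_upd f j x t d :
  is_derive (fun s => f (upd x j s)) t d <-> has_partial f j (upd x j t) d.
Proof.
rewrite has_partialE updE.
suff -> : (fun s => f (upd (upd x j t) j s)) = (fun s => f (upd x j s)) by [].
by apply: functional_extensionality => s; rewrite upd_upd.
Qed.

Lemma Ck_cont k V f : Ck k V f -> cont_on V f.
Proof. by case: k => [|k] //= []. Qed.

Lemma eq_on_open_locally V f g x : is_open V -> V x -> (forall y, V y -> f y = g y) ->
  locally x (fun y => f y = g y).
Proof. by move=> oV Vx fg; apply: filter_imp (is_open_locally oV Vx). Qed.

Lemma Ck_continuous k V f x : is_open V -> Ck k V f -> V x -> continuous f x.
Proof. by move=> oV /Ck_cont; exact: cont_on_continuous. Qed.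

Lemma Ck_ext k V f g : is_open V -> (forall x, V x -> f x = g x) -> Ck k V f -> Ck k V g.
Proof.
move=> oV fg; case: k => [|k] /=; first exact: cont_on_ext.
case=> cf Df; split; first exact: cont_on_ext cf.
move=> j; have [d [Dd Cd]] := Df j; exists d; split=> // x Vx.
by apply: (has_partial_ext_loc (eq_on_open_locally oV Vx fg)); apply: Dd.
Qed.

Lemma Ck_succ k V f : is_open V ->
  Ck k.+1 V f <-> cont_on V f /\
    forall j, (forall x, V x -> has_partial f j x (pd f j x)) /\ Ck k V (pd f j).
Proof.
move=> oV; split=> -[cf Df]; split=> // j.
- have [d [Dd Cd]] := Df j; split=> [x /Dd /has_partial_pd //|].
  by apply: Ck_ext Cd => // x /Dd /has_partial_unique.
- by exists (pd f j); exact: Df.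
Qed.

Lemma Ck_le m k V f : (m <= k)%N -> Ck k V f -> Ck m V f.
Proof.
elim: k m f => [|k IH] [|m] f //= mk [cf Df] //; split=> // j.
by have [d [Dd Cd]] := Df j; exists d; split=> //; exact: IH Cd.
Qed.

Lemma Ck_sub k V W f : (forall x, W x -> V x) -> Ck k V f -> Ck k W f.
Proof.
move=> WV; elim: k f => [|k IH] f /=; first exact: cont_on_sub.
case=> cf Df; split; first exact: cont_on_sub cf.
by move=> j; have [d [Dd Cd]] := Df j; exists d; split; auto.
Qed.

Lemma Ck_locally k V f : is_open V ->
  (forall x, V x -> exists W, is_open W /\ W x /\ Ck k W f) -> Ck k V f.
Proof.
move=> oV; elim: k f => [|k IH] f locf; first exact: cont_on_locally locf.
apply/Ck_succ => //; split.
  by apply: cont_on_locally => x /locf [W [oW [Wx [cf _]]]]; exists W.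
move=> j; split=> [x /locf [W [oW [Wx /(Ck_succ _ _ oW) [_ Cf]]]]|].
  by have [Dd _] := Cf j; apply: Dd.
apply: IH => x /locf [W [oW [Wx /(Ck_succ _ _ oW) [_ Cf]]]]; exists W.
by have [] := Cf j.
Qed.

Lemma Ck_const k V c : Ck k V (fun _ => c).
Proof.
elim: k c => [|k IH] c /=; first exact: cont_on_const.
split=> [|j]; first exact: cont_on_const.
by exists (fun _ => 0); split=> // x _; apply: derivable_pt_lim_const.
Qed.

Lemma Ck_coord k V i : Ck k V (fun x => x i).
Proof.
case: k => [|k] /=; first exact: cont_on_coord.
split=> [|j]; first exact: cont_on_coord.
exists (fun _ => if i == j then 1 else 0); split; last exact: Ck_const.
move=> x _; rewrite /has_partial /upd; case: eqP => _.
- exact: derivable_pt_lim_id.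
- exact: derivable_pt_lim_const.
Qed.

Lemma Ck_plus k V f g : Ck k V f -> Ck k V g -> Ck k V (fun x => f x + g x).
Proof.
elim: k f g => [|k IH] f g /=; first exact: cont_on_plus.
case=> cf Df [cg Dg]; split=> [|j]; first exact: cont_on_plus.
have [df [Ddf Cdf]] := Df j; have [dg [Ddg Cdg]] := Dg j.
exists (fun x => df x + dg x); split; last exact: IH.
by move=> x Vx; apply: (derivable_pt_lim_plus _ _ _ _ _ (Ddf _ Vx) (Ddg _ Vx)).
Qed.

Lemma has_partial_mult f g j x df dg : has_partial f j x df -> has_partial g j x dg ->
  has_partial (fun y => f y * g y) j x (df * g x + f x * dg).
Proof. by move=> Df Dg; have := derivable_pt_lim_mult _ _ _ _ _ Df Dg; rewrite upd_id. Qed.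

Lemma Ck_mult k V f g : Ck k V f -> Ck k V g -> Ck k V (fun x => f x * g x).
Proof.
elim: k f g => [|k IH] f g; first exact: cont_on_mult.
move=> Cf Cg; have Cf' := Ck_le (leqnSn k) Cf; have Cg' := Ck_le (leqnSn k) Cg.
case: Cf => cf Df; case: Cg => cg Dg; split=> [|j]; first exact: cont_on_mult.
have [df [Ddf Cdf]] := Df j; have [dg [Ddg Cdg]] := Dg j.
exists (fun x => df x * g x + f x * dg x); split; last by apply: Ck_plus; apply: IH.
by move=> x Vx; apply: has_partial_mult; [exact: Ddf|exact: Ddg].
Qed.

Lemma Ck_big (op : R -> R -> R) (idx : R) k V (I : Type) (r : seq I) (F : I -> vec n -> R) :
  (forall f g, Ck k V f -> Ck k V g -> Ck k V (fun x => op (f x) (g x))) ->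
  (forall i : I, Ck k V (F i)) -> Ck k V (fun x => \big[op/idx]_(i <- r) F i x).
Proof.
move=> Cop CF; elim: r => [|i r IH].
- rewrite (_ : (fun x => _) = fun _ => idx); first exact: Ck_const.
  by apply: functional_extensionality => x; rewrite big_nil.
- rewrite (_ : (fun x => _) = fun x => op (F i x) (\big[op/idx]_(i <- r) F i x)).
    exact: Cop.
  by apply: functional_extensionality => x; rewrite big_cons.
Qed.

Lemma Ck_sum k V (I : Type) (r : seq I) (F : I -> vec n -> R) :
  (forall i : I, Ck k V (F i)) -> Ck k V (fun x => \big[Rplus/0]_(i <- r) F i x).
Proof. exact/Ck_big/Ck_plus. Qed.

Lemma Ck_prod k V (I : Type) (r : seq I) (F : I -> vec n -> R) :
  (forall i : I, Ck k V (F i)) -> Ck k V (fun x => \big[Rmult/1]_(i <- r) F i x).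
Proof. exact/Ck_big/Ck_mult. Qed.

Lemma Ck_pow k V f m : Ck k V f -> Ck k V (fun x => f x ^ m).
Proof. by move=> Cf; elim: m => [|m IH] /=; [exact: Ck_const|exact: Ck_mult]. Qed.

Lemma Ck_mono k V al : Ck k V (mono al).
Proof. by apply: Ck_prod => i; apply/Ck_pow/Ck_coord. Qed.

Lemma Ck_inv_coord k V j : (forall x, V x -> x j <> 0) -> Ck k V (fun x => / x j).
Proof.
move=> Vj; have cinv : cont_on V (fun x => / x j).
  apply/cont_onE/continuous_on_forall => x /Vj xj.
  apply: (continuous_comp (fun y : vec n => y j) Rinv); last exact: continuous_Rinv.
  exact: continuous_coord.
elim: k => [|k IH] //=; split=> // i.
exists (fun x => (if j == i then -1 else 0) * (/ x j * / x j)); split.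
  move=> x /Vj xj; rewrite /has_partial /upd; case: eqP => [<-|_].
  - by apply/is_derive_Reals; auto_derive=> //; field.
  - rewrite Rmult_0_l; exact: derivable_pt_lim_const.
by apply: Ck_mult; [exact: Ck_const|exact: Ck_mult].
Qed.

Lemma smooth_pd V f j : is_open V -> smooth_on V f -> smooth_on V (pd f j).
Proof. by move=> oV sf k; have /(Ck_succ _ _ oV) [_ /(_ j) []] := sf k.+1. Qed.

Lemma Ck1_has_partial V f j x : is_open V -> Ck 1 V f -> V x -> has_partial f j x (pd f j x).
Proof. by move=> oV /(Ck_succ _ _ oV) [_ /(_ j) [Df _]]; apply: Df. Qed.

End Smoothness.

Lemma filterlim_uniform_segment (T : UniformSpace) (G : R -> T -> R) (a b : R) (y : T) :
  (forall t, a <= t <= b -> filterlim (fun q : R * T => G q.1 q.2)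
     (filter_prod (locally t) (locally y)) (locally (G t y))) ->
  forall eps : posreal,
    locally y (fun z => forall t, a <= t <= b -> Rabs (G t z - G t y) < eps).
Proof.
move=> contG eps.
have radius t : {d : posreal | a <= t <= b ->
    forall s z, ball t d s -> ball y d z -> Rabs (G s z - G t y) < eps / 2}.
  apply: constructive_indefinite_description.
  have [tab|tab] := classic (a <= t <= b); last by exists eps.
  have /filterlim_locally/(_ (pos_div_2 eps)) [P Q [dP ballP] [dQ ballQ] PQ] := contG t tab.
  exists (mkposreal _ (Rmin_stable_in_posreal dP dQ)) => _ s z st yz.
  apply: PQ.
  - by apply: ballP; apply: ball_le st; exact: Rmin_l.
  - by apply: ballQ; apply: ball_le yz; exact: Rmin_r.
have [d cover] := compactness_value_1d a b (fun t => sval (radius t)).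
exists d => z yz s sab; have /NNPP [t [tab [st dt]]] := cover s sab.
have close := svalP (radius t) tab s.
have Gz := close z st (ball_le _ _ _ dt _ yz).
have Gy := close y st (ball_center _ _).
by move: Gz Gy; split_Rabs; lra.
Qed.

Lemma unit_segmentP t : Rmin 0 1 <= t <= Rmax 0 1 -> 0 <= t <= 1.
Proof. by rewrite Rmin_left ?Rmax_right; lra. Qed.

Section SegmentAverage.
Variables (n : nat) (j : 'I_n) (c : R).
Implicit Types (y : vec n) (h : vec n -> R) (i : 'I_n).

Definition slide (t : R) y := upd y j (c + t * (y j - c)).
(* The weight [t ^ m] makes these averages stable under partial derivatives. *)
Definition slice m h t y := t ^ m * h (slide t y).
Definition average m h y : R := RInt (fun t => slice m h t y) 0 1.

Lemma slide_ball p r t y : p j = c -> 0 <= t <= 1 -> ball p r y -> ball p r (slide t y).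
Proof.
move=> pj t01 py i; rewrite /slide /upd; case: eqP => [->|_]; last exact: py.
have yj : Rabs (y j - p j) < r := py j.
change (Rabs (c + t * (y j - c) - p j) < r); rewrite pj.
rewrite (_ : _ - c = t * (y j - p j)); last by rewrite pj; ring.
by rewrite Rabs_mult Rabs_pos_eq; [have := Rabs_pos (y j - p j); nra|lra].
Qed.

Lemma average_const_slide h y : y j = c -> average 0 h y = h y.
Proof.
move=> yj; rewrite /average (RInt_ext _ (fun _ => h y)) => [|t _].
  by rewrite RInt_const /scal /= /mult /=; ring.
by rewrite /slice /slide -yj Rminus_diag Rmult_0_r Rplus_0_r upd_id /=; ring.
Qed.

Lemma is_derive_slide h y t d : has_partial h j (slide t y) d ->
  is_derive (fun s => h (slide s y)) t ((y j - c) * d).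
Proof.
move/is_derive_upd => Dh.
apply: (@is_derive_comp _ _ (fun s => h (upd y j s)) (fun t => c + t * (y j - c))) => //.
by auto_derive=> //; ring.
Qed.

Lemma slide0 y : slide 0 y = upd y j c.
Proof. by rewrite /slide Rmult_0_l Rplus_0_r. Qed.

Lemma slide1 y : slide 1 y = y.
Proof. by rewrite /slide Rmult_1_l (_ : c + (y j - c) = y j) ?upd_id //; ring. Qed.

Lemma filterlim_slide {T : Type} {F : (T -> Prop) -> Prop} {FF : Filter F}
    (u : T -> R) (v : T -> vec n) t y :
  filterlim u F (locally t) -> filterlim v F (locally y) ->
  filterlim (fun q => slide (u q) (v q)) F (locally (slide t y)).
Proof.
move=> ut vy; apply: filterlim_upd => //; apply: filterlim_Rplus; first exact: filterlim_const.
apply: filterlim_Rmult => //; apply: filterlim_Rplus; last exact: filterlim_const.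
exact: filterlim_coord.
Qed.

Lemma locally_slide (P : vec n -> Prop) t y :
  locally (slide t y) P -> locally t (fun s => P (slide s y)).
Proof. exact: (filterlim_slide (filterlim_id _ _) (filterlim_const y)). Qed.

Lemma filterlim_slice {T : Type} {F : (T -> Prop) -> Prop} {FF : Filter F}
    m h (u : T -> R) (v : T -> vec n) t y :
  continuous h (slide t y) -> filterlim u F (locally t) -> filterlim v F (locally y) ->
  filterlim (fun q => slice m h (u q) (v q)) F (locally (slice m h t y)).
Proof.
move=> ch ut vy; apply: filterlim_Rmult.
  apply: (filterlim_comp _ _ _ u (fun s => s ^ m) _ _ _ ut).
  by apply: ex_derive_continuous; auto_derive.
by apply: filterlim_comp ch; exact: filterlim_slide.
Qed.

Variable W : vec n -> Prop.
Hypothesis oW : is_open W.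
Hypothesis slideW : forall t y, 0 <= t <= 1 -> W y -> W (slide t y).

Lemma ex_RInt_slice m h y : cont_on W h -> W y -> ex_RInt (fun t => slice m h t y) 0 1.
Proof.
move=> ch Wy; apply: ex_RInt_continuous => t /unit_segmentP t01.
apply: filterlim_slice (filterlim_id _ _) (filterlim_const _).
exact: cont_on_continuous oW ch (slideW t01 Wy).
Qed.

Lemma average_cont m h : cont_on W h -> cont_on W (average m h).
Proof.
move=> ch; apply/cont_onE/continuous_on_forall => y Wy.
have slice_cont t : 0 <= t <= 1 -> filterlim (fun q : R * vec n => slice m h q.1 q.2)
    (filter_prod (locally t) (locally y)) (locally (slice m h t y)).
  move=> t01; apply: filterlim_slice filterlim_fst filterlim_snd.
  exact: cont_on_continuous oW ch (slideW t01 Wy).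
apply/filterlim_locally => eps.
have unif := filterlim_uniform_segment slice_cont (pos_div_2 eps).
apply: filter_imp (filter_and _ _ (is_open_locally oW Wy) unif) => z [Wz close].
change (Rabs (average m h z - average m h y) < eps).
rewrite /average (_ : _ - _ = RInt (fun t => minus (slice m h t z) (slice m h t y)) 0 1);
  last by rewrite RInt_minus //; exact: ex_RInt_slice.
apply: (@Rle_lt_trans _ ((1 - 0) * (eps / 2))); last by have := cond_pos eps; lra.
apply: abs_RInt_le_const => [||t t01]; first lra.
  by apply: ex_RInt_minus; exact: ex_RInt_slice.
by apply: Rlt_le; exact: close.
Qed.

Lemma slice_partial m h i t y :
  has_partial h i (slide t y) (pd h i (slide t y)) ->
  has_partial (slice m h t) i y (slice (if i == j then m.+1 else m) (pd h i) t y).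
Proof.
move=> Dh; apply/has_partialE; rewrite /slice; move: Dh; rewrite /slide.
case: eqP => [->|/eqP ij].
  move/is_derive_upd => Dh.
  apply: (@is_derive_ext _ _ (fun u => t ^ m * h (upd y j (c + t * (u - c))))).
    by move=> u; rewrite upd_upd updE.
  rewrite (_ : t ^ m.+1 * _ = t ^ m * (t * pd h j (upd y j (c + t * (y j - c)))));
    last by rewrite /=; ring.
  apply: is_derive_scal.
  apply: (@is_derive_comp _ _ (fun s => h (upd y j s)) (fun u => c + t * (u - c))) => //.
  by auto_derive=> //; ring.
move/has_partialE; rewrite upd_neq // => Dh.
apply: is_derive_scal; apply: is_derive_ext Dh => u.
by rewrite (upd_neq _ _ (i := j)) 1?eq_sym // upd_comm 1?eq_sym.
Qed.

Lemma slice_derive m h i u t y : (forall x, W x -> has_partial h i x (pd h i x)) ->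
  W (slide t (upd y i u)) ->
  is_derive (fun v => slice m h t (upd y i v)) u
    (slice (if i == j then m.+1 else m) (pd h i) t (upd y i u)).
Proof. by move=> Dh Wu; apply/is_derive_upd/slice_partial/Dh. Qed.

Lemma slice_Derive_continuity m h i t y :
  (forall x, W x -> has_partial h i x (pd h i x)) -> cont_on W (pd h i) ->
  W (slide t y) ->
  continuity_2d_pt (fun u v => Derive (fun w => slice m h v (upd y i w)) u) (y i) t.
Proof.
move=> Dh cd Wt.
have lim_upd : filterlim (fun q : R * R => upd y i q.1) (locally (y i, t)) (locally y).
  rewrite -[X in filterlim _ _ (locally X)](upd_id y i).
  by apply: filterlim_upd; [exact: filterlim_const|exact: continuous_fst].
have lim_snd : filterlim snd (locally (y i, t)) (locally t) := continuous_snd _ _.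
apply/continuity_2d_pt_filterlim.
rewrite (is_derive_unique _ _ _ (slice_derive (u := y i) m Dh _)) upd_id //.
apply: filterlim_ext_loc; last first.
  exact: filterlim_slice (cont_on_continuous oW cd Wt) lim_snd lim_upd.
have Wslide : locally (y i, t) (fun q : R * R => W (slide q.2 (upd y i q.1))).
  by apply: (filterlim_slide lim_snd lim_upd); exact: is_open_locally.
by apply: filter_imp Wslide => q /(slice_derive m Dh) /is_derive_unique.
Qed.

Lemma average_partial m h i y : cont_on W h ->
  (forall x, W x -> has_partial h i x (pd h i x)) -> cont_on W (pd h i) -> W y ->
  has_partial (average m h) i y (average (if i == j then m.+1 else m) (pd h i) y).
Proof.
move=> ch Dh cd Wy; have Wy_upd := locally_upd i (is_open_locally oW Wy).
apply/has_partialE; rewrite {2}/average.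
rewrite -(RInt_ext (fun t => Derive (fun u => slice m h t (upd y i u)) (y i))) => [|t t01].
  apply: (@is_derive_RInt_param (fun u t => slice m h t (upd y i u))).
  - apply: filter_imp Wy_upd => u Wu t /unit_segmentP t01.
    by eexists; apply/(slice_derive m Dh)/slideW.
  - by move=> t /unit_segmentP t01; apply/slice_Derive_continuity/slideW.
  - by apply: filter_imp Wy_upd => u Wu; exact: ex_RInt_slice.
rewrite -[X in _ = slice _ _ _ X](upd_id y i); apply/is_derive_unique/(slice_derive m Dh).
by rewrite upd_id; apply/slideW/Wy/unit_segmentP; lra.
Qed.

Lemma average_Ck k m h : Ck k W h -> Ck k W (average m h).
Proof.
elim: k m h => [|k IH] m h Ch; first exact: average_cont.
move/(Ck_succ _ _ oW): (Ch) => [ch Dh]; split=> [|i]; first exact: average_cont.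
have [Dhi Ci] := Dh i.
exists (average (if i == j then m.+1 else m) (pd h i)); split; last exact: IH.
by move=> y Wy; apply: average_partial => //; exact: Ck_cont Ci.
Qed.

Lemma hadamard h y : Ck 1 W h -> W y ->
  h y - h (upd y j c) = (y j - c) * average 0 (pd h j) y.
Proof.
move=> /(Ck_succ _ _ oW) [_ /(_ j) [Dh cd]] Wy.
have fundamental : is_RInt (fun t => (y j - c) * slice 0 (pd h j) t y) 0 1
    (minus (h (slide 1 y)) (h (slide 0 y))).
  apply: (@is_RInt_derive _ (fun t => h (slide t y))) => t /unit_segmentP t01;
    have Wt := slideW t01 Wy.
    by rewrite /slice /= Rmult_1_l; apply/is_derive_slide/Dh.
  apply: (@continuous_scal_r _ _ _ (y j - c) (fun t => slice 0 (pd h j) t y)).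
  apply: filterlim_slice (filterlim_id _ _) (filterlim_const _).
  exact: cont_on_continuous cd Wt.
have scaled : is_RInt (fun t => (y j - c) * slice 0 (pd h j) t y) 0 1
    ((y j - c) * average 0 (pd h j) y).
  apply: (@is_RInt_scal _ (fun t => slice 0 (pd h j) t y)).
  by apply: RInt_correct; apply: ex_RInt_slice.
rewrite -(is_RInt_unique _ _ _ _ scaled) (is_RInt_unique _ _ _ _ fundamental).
by rewrite slide1 slide0.
Qed.

End SegmentAverage.

Lemma is_derive_mult_vanishing (g u : R -> R) t0 d :
  continuous g t0 -> u t0 = 0 -> is_derive u t0 d ->
  is_derive (fun t => g t * u t) t0 (g t0 * d).
Proof.
move=> /continuity_pt_filterlim cg u0 /is_derive_Reals Du.
have lim_u := proj2 (derivable_pt_lim_D_in u (fun _ => d) t0) Du.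
apply/is_derive_Reals/(derivable_pt_lim_D_in _ (fun _ => g t0 * d)).
have := limit_mul _ _ _ _ _ _ cg lim_u; apply: limit1_ext => t _.
by rewrite u0 /Rdiv; ring.
Qed.

Section ChainRule.
Variable n : nat.
Implicit Types (x y p : vec n) (U V : vec n -> Prop) (f g : vec n -> R) (i j : 'I_n).

(* By Hadamard's lemma the increment is [w t j - w t0 j] times a function of [t] which
   is only continuous; as the first factor vanishes at [t0], this is enough. *)
Lemma is_derive_coord_increment U f (w : R -> vec n) t0 j d :
  is_open U -> Ck 1 U f -> U (w t0) -> continuous w t0 ->
  is_derive (fun t => w t j) t0 d ->
  is_derive (fun t => f (w t) - f (upd (w t) j (w t0 j))) t0 (pd f j (w t0) * d).
Proof.
move=> oU Cf Uw cw Dw; set p := w t0.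
have [r [r0 WU]] := is_open_subset_ball oU Uw.
have oW : is_open (ball p r) by exact: is_open_ball.
have CfW := Ck_sub WU Cf.
have slideW t y : 0 <= t <= 1 -> ball p r y -> ball p r (slide j (p j) t y).
  exact: slide_ball.
have Wp : ball p r p := ball_center p (mkposreal _ r0).
have [_ /(_ j) [_ cpd]] := proj1 (Ck_succ _ _ oW) CfW.
have cavg : continuous (average j (p j) 0 (pd f j)) p.
  exact: cont_on_continuous oW (average_cont oW slideW _ cpd) Wp.
rewrite -(average_const_slide (pd f j) (erefl (p j))).
apply: (is_derive_ext_loc (fun t => average j (p j) 0 (pd f j) (w t) * (w t j - p j))).
  have Wloc : locally t0 (fun t => ball p r (w t)) := cw _ (is_open_locally oW Wp).
  apply: filter_imp Wloc => t Wt.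
  by rewrite (hadamard oW slideW CfW Wt) Rmult_comm.
apply: (is_derive_mult_vanishing (g := fun t => average j (p j) 0 (pd f j) (w t))).
- exact: continuous_comp cw cavg.
- by rewrite /p Rminus_diag.
- by rewrite -(Rminus_0_r d); apply: is_derive_minus => //; exact: is_derive_const.
Qed.

Lemma chain_rule U f (ga : R -> vec n) t0 (d : vec n) :
  is_open U -> Ck 1 U f -> U (ga t0) ->
  (forall i, is_derive (fun t => ga t i) t0 (d i)) ->
  is_derive (fun t => f (ga t)) t0 (\big[Rplus/0]_(i < n) (pd f i (ga t0) * d i)).
Proof.
move=> oU Cf Uga Dga.
pose switch (s : seq 'I_n) t : vec n := fun i => if i \in s then ga t i else ga t0 i.
have switch0 s : switch s t0 = ga t0.
  by apply: functional_extensionality => i; rewrite /switch; case: ifP.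
suff switch_derive s : uniq s ->
    is_derive (fun t => f (switch s t)) t0 (\big[Rplus/0]_(i <- s) (pd f i (ga t0) * d i)).
  apply: is_derive_ext (switch_derive _ (index_enum_uniq _)) => t; congr f.
  by apply: functional_extensionality => i; rewrite /switch mem_index_enum.
elim: s => [_|j s IH /= /andP [js us]].
  by rewrite big_nil; exact: (is_derive_const (f (ga t0))).
have cswitch : continuous (switch (j :: s)) t0.
  apply: filterlim_vec => i; rewrite switch0 /switch.
  case: (i \in j :: s); last exact: filterlim_const.
  by apply: ex_derive_continuous; exists (d i).
rewrite big_cons Rplus_comm; apply: (is_derive_ext (fun t => f (switch s t) +
    (f (switch (j :: s) t) - f (upd (switch (j :: s) t) j (ga t0 j))))) => [t|].
  rewrite (_ : upd _ j _ = switch s t); first by simpl; ring.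
  apply: functional_extensionality => i; rewrite /upd /switch in_cons.
  by case: eqP => // ->; rewrite (negbTE js).
apply: is_derive_plus; first exact: IH.
rewrite -(switch0 (j :: s)); apply: (is_derive_coord_increment oU Cf) => //.
  by rewrite switch0.
by apply: is_derive_ext (Dga j) => t; rewrite /switch mem_head.
Qed.

End ChainRule.

Section Composition.
Variables (m n : nat) (U : vec n -> Prop) (V : vec m -> Prop) (phi : vec m -> vec n).
Hypotheses (oU : is_open U) (oV : is_open V) (VU : forall y, V y -> U (phi y)).

Lemma cont_on_comp g : (forall i, cont_on V (fun y => phi y i)) -> cont_on U g ->
  cont_on V (fun y => g (phi y)).
Proof.
move=> cphi cg; apply/cont_onE/continuous_on_forall => y Vy.
apply: (continuous_comp phi g); last exact: cont_on_continuous (VU Vy).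
by apply: filterlim_vec => i; exact: cont_on_continuous (cphi i) Vy.
Qed.

Lemma has_partial_comp f j y : Ck 1 U f -> (forall i, Ck 1 V (fun y => phi y i)) -> V y ->
  has_partial (fun y => f (phi y)) j y
    (\big[Rplus/0]_(i < n) (pd f i (phi y) * pd (fun y => phi y i) j y)).
Proof.
move=> Cf Cphi Vy; apply/has_partialE.
have := @chain_rule _ U f (fun t => phi (upd y j t)) (y j) (fun i => pd (fun y => phi y i) j y).
rewrite upd_id; apply=> //; first exact: VU.
by move=> i; have /has_partialE := Ck1_has_partial j oV (Cphi i) Vy.
Qed.

Lemma Ck_comp k f : (forall i, Ck k V (fun y => phi y i)) -> Ck k U f ->
  Ck k V (fun y => f (phi y)).
Proof.
elim: k f => [|k IH] f Cphi Cf; first exact: cont_on_comp.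
have [cf Df] := proj1 (Ck_succ _ _ oU) Cf.
split=> [|j]; first by apply: cont_on_comp => // i; exact: Ck_cont (Cphi i).
exists (fun y => \big[Rplus/0]_(i < n) (pd f i (phi y) * pd (fun y => phi y i) j y)); split.
  move=> y Vy; apply: has_partial_comp => // [|i]; [exact: Ck_le Cf|exact: Ck_le (Cphi i)].
apply: Ck_sum => i; have [_ /(_ j) [_ Cphij]] := proj1 (Ck_succ _ _ oV) (Cphi i).
by apply: Ck_mult => //; apply: IH => [l|]; [exact: Ck_le (leqnSn k) (Cphi l)|have [_] := Df i].
Qed.

End Composition.

Section Division.
Variables (n : nat) (V : vec n -> Prop).
Hypothesis oV : is_open V.
Implicit Types (x y p : vec n) (f g h : vec n -> R) (i j : 'I_n).

Definition div_coord h j y : R := if y j == 0 then pd h j y else h y / y j.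

Lemma div_coord_average h j p r y : p j = 0 -> Ck 1 (ball p r) h -> ball p r y ->
  (forall z, ball p r z -> z j = 0 -> h z = 0) ->
  div_coord h j y = average j 0 0 (pd h j) y.
Proof.
move=> pj Ch Wy h_wall; have slideW t z := @slide_ball _ j 0 p r t z pj.
rewrite /div_coord; case: eqP => [yj|yj]; first by rewrite average_const_slide.
have := hadamard (is_open_ball (r := r)) slideW Ch Wy.
rewrite (h_wall (upd y j 0)) ?updE // => [|]; last first.
  by rewrite -slide0; apply: slideW => //; lra.
by rewrite !Rminus_0_r => ->; field.
Qed.

Lemma smooth_div_coord h j : smooth_on V h -> (forall y, V y -> y j = 0 -> h y = 0) ->
  exists g, smooth_on V g /\ forall y, V y -> h y = y j * g y.
Proof.
move=> sh h_wall; exists (div_coord h j); split=> [k|y Vy]; last first.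
  by rewrite /div_coord; case: eqP => [yj|yj]; [rewrite h_wall // yj; ring|field].
apply: Ck_locally => // p Vp; have [pj|/eqP pj] := eqVneq (p j) 0.
  have [r [r0 WV]] := is_open_subset_ball oV Vp.
  have oW : is_open (ball p r) by exact: is_open_ball.
  exists (ball p r); split=> //; split; first exact: (ball_center p (mkposreal _ r0)).
  apply: (@Ck_ext _ _ _ (average j 0 0 (pd h j))) => //.
    move=> y Wy; rewrite (div_coord_average pj _ Wy) //; first exact: Ck_sub (sh 1%N).
    by move=> z /WV; exact: h_wall.
  apply: average_Ck => // [t y|]; first exact: slide_ball.
  exact: Ck_sub (smooth_pd j oV sh k).
exists (fun y => V y /\ ball p (Rabs (p j)) y).
have yj y : V y /\ ball p (Rabs (p j)) y -> y j <> 0.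
  move=> [_ py] yj0; have : Rabs (y j - p j) < Rabs (p j) := py j.
  by rewrite yj0; split_Rabs; lra.
have oW : is_open (fun y => V y /\ ball p (Rabs (p j)) y).
  by apply: is_open_and => //; exact: is_open_ball.
split=> //; split.
  by split=> //; exact: (ball_center p (mkposreal _ (Rabs_pos_lt _ pj))).
apply: (@Ck_ext _ _ _ (fun y => h y * / y j)) => //.
  by move=> y /yj /eqP yj0; rewrite /div_coord (negbTE yj0).
by apply: Ck_mult; [apply: Ck_sub (sh k) => y []|exact: Ck_inv_coord].
Qed.

(* Only points off the other coordinate hyperplanes are tested: there the
   condition survives division by the other coordinates. *)
Definition wall_limit h j (l : nat) := forall y, V y -> y j = 0 ->
  (forall i, i != j -> y i <> 0) ->
  exists L : R, filterlim (fun t => h (upd y j t) / t ^ l) (at_right 0) (locally L).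

Lemma continuous_generic_wall_zero h j y : continuous h y -> y j = 0 ->
  locally y (fun z => z j = 0 -> (forall i, i != j -> z i <> 0) -> h z = 0) -> h y = 0.
Proof.
move=> ch yj h_wall.
pose perturb (t : R) : vec n := fun i => if (i == j) || (y i != 0) then y i else t.
have perturb_lim : filterlim perturb (at_right 0) (locally y).
  apply: filterlim_vec => i; rewrite /perturb.
  case: eqP => _ /=; first exact: filterlim_const.
  have [->|_] /= := eqVneq (y i) 0; last exact: filterlim_const.
  exact: (filterlim_at_right (f := fun t => t)) (filterlim_id _ _).
apply: (filterlim_locally_unique (F := at_right 0) (fun t => h (perturb t))).
  exact: filterlim_comp perturb_lim ch.
apply: filterlim_ext_loc (filterlim_const 0).
have h_perturb := perturb_lim _ h_wall.
apply: filter_imp (filter_and _ _ (at_right_gt 0) h_perturb) => t [t0 ->] //.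
  by rewrite /perturb eqxx.
move=> i /negbTE ij; rewrite /perturb ij /=.
by have [_|/eqP] := eqVneq (y i) 0 => //=; lra.
Qed.

Lemma wall_limit_zero h j l : cont_on V h -> wall_limit h j l.+1 ->
  forall y, V y -> y j = 0 -> h y = 0.
Proof.
move=> ch lim_h y Vy yj.
apply: (continuous_generic_wall_zero (cont_on_continuous oV ch Vy) yj).
apply: filter_imp (is_open_locally oV Vy) => z Vz zj zi.
have [L limL] := lim_h z Vz zj zi.
have lim_upd : filterlim (upd z j) (at_right 0) (locally z).
  rewrite -[X in locally X](upd_id z j) zj.
  exact/filterlim_at_right/continuous_upd.
apply: (filterlim_locally_unique (F := at_right 0) (fun t => h (upd z j t))).
  exact: filterlim_comp lim_upd (cont_on_continuous oV ch Vz).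
rewrite -[X in locally X](Rmult_0_r L).
apply: filterlim_ext_loc (filterlim_Rmult limL (filterlim_pow_at_right0 l)).
apply: filter_imp (at_right_gt 0) => t t0; field; apply: pow_nonzero; lra.
Qed.

Lemma wall_limit_div_coord h g j k l : (forall y, V y -> h y = y j * g y) ->
  wall_limit h k ((k == j) + l) -> wall_limit g k l.
Proof.
move=> hE lim_h y Vy yk yi; have [L limL] := lim_h y Vy yk yi.
have := at_right_upd k (is_open_locally oV Vy); rewrite yk => Vupd.
have [kj|kj] := eqVneq k j.
  subst k; exists L; apply: filterlim_ext_loc limL.
  apply: filter_imp Vupd => t [t0 /hE ->]; rewrite updE eqxx add1n /=.
  field; split; [exact: pow_nonzero (Rgt_not_eq _ _ t0)|lra].
exists (/ y j * L); apply: filterlim_ext_loc (filterlim_Rmult (filterlim_const (/ y j)) limL).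
apply: filter_imp Vupd => t [t0 /hE ->]; rewrite (negbTE kj) add0n upd_neq 1?eq_sym //.
field; split; [exact: pow_nonzero (Rgt_not_eq _ _ t0)|by apply: yi; rewrite eq_sym].
Qed.

Lemma smooth_div_seq (js : seq 'I_n) h : smooth_on V h ->
  (forall j, wall_limit h j (count_mem j js)) ->
  exists g, smooth_on V g /\ forall y, V y -> h y = (\big[Rmult/1]_(j <- js) y j) * g y.
Proof.
elim: js h => [|j js IH] h sh lim_h.
  by exists h; split=> // y _; rewrite big_nil Rmult_1_l.
have [|g [sg gE]] := smooth_div_coord (j := j) sh.
  by apply: (@wall_limit_zero _ _ (count_mem j js)) (sh 0%N) _; have := lim_h j; rewrite /= eqxx.
have [k|q [sq qE]] := IH g sg; last first.
  by exists q; split=> // y Vy; rewrite big_cons gE // qE // Rmult_assoc.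
by apply: wall_limit_div_coord gE _; have := lim_h k; rewrite /= eq_sym.
Qed.

Lemma count_mlist (al : mindex n) j : count_mem j (mlist al) = al j.
Proof.
rewrite /mlist count_flatten -map_comp sumnE big_map big_enum (bigD1 j) //=.
rewrite count_nseq /= eqxx mul1n big1 ?addn0 // => i /negbTE ij.
by rewrite count_nseq /= ij.
Qed.

Lemma prod_mlist (al : mindex n) y : \big[Rmult/1]_(j <- mlist al) y j = mono al y.
Proof.
rewrite /mlist big_flatten big_map big_enum /=; apply: eq_bigr => j _.
by elim: (al j) => [|m IH] /=; rewrite ?big_nil ?big_cons ?IH.
Qed.

Lemma smooth_div_mono (al : mindex n) h : smooth_on V h ->
  (forall j, wall_limit h j (al j)) ->
  exists g, smooth_on V g /\ forall y, V y -> h y = mono al y * g y.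
Proof.
move=> sh lim_h; have [|g [sg gE]] := @smooth_div_seq (mlist al) h sh.
  by move=> j; rewrite count_mlist.
by exists g; split=> // y Vy; rewrite gE // prod_mlist.
Qed.

End Division.

Section Taylor.
Variable n : nat.
Implicit Types (x y : vec n) (V : vec n -> Prop) (f g h : vec n -> R) (i j : 'I_n).
Implicit Types (al : mindex n) (e : {ffun 'I_n -> nat}) (js : seq 'I_n).

Definition pdn k j f := iter k (fun g => pd g j) f.

Lemma smooth_pdn V f j k : is_open V -> smooth_on V f -> smooth_on V (pdn k j f).
Proof. by move=> oV sf; elim: k => [|k IH] //=; apply: smooth_pd. Qed.

Lemma is_derive_pdn_slide V f j c x k t : is_open V -> smooth_on V f -> V (slide j c t x) ->
  is_derive (fun s => (x j - c) ^ k * pdn k j f (slide j c s x)) t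
    ((x j - c) ^ k.+1 * pdn k.+1 j f (slide j c t x)).
Proof.
move=> oV sf Vt; rewrite (_ : _ * _ = (x j - c) ^ k *
  ((x j - c) * pdn k.+1 j f (slide j c t x))); last by rewrite /=; ring.
apply/is_derive_scal/is_derive_slide/Ck1_has_partial; try eassumption.
exact: smooth_pdn.
Qed.

Lemma Derive_n_slide V f j c x k t : is_open V -> smooth_on V f -> V (slide j c t x) ->
  Derive_n (fun s => f (slide j c s x)) k t = (x j - c) ^ k * pdn k j f (slide j c t x).
Proof.
move=> oV sf; elim: k t => [|k IH] t Vt; first by rewrite Rmult_1_l.
rewrite -(is_derive_unique _ _ _ (is_derive_pdn_slide k oV sf Vt)).
apply: Derive_ext_loc.
by apply: filter_imp (locally_slide (is_open_locally oV Vt)) => s /IH.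
Qed.

Lemma ex_derive_n_slide V f j c x k t : is_open V -> smooth_on V f -> V (slide j c t x) ->
  ex_derive_n (fun s => f (slide j c s x)) k t.
Proof.
move=> oV sf Vt; case: k => [|k] //=; eexists.
apply: is_derive_ext_loc (is_derive_pdn_slide k oV sf Vt).
apply: filter_imp (locally_slide (is_open_locally oV Vt)) => s Vs.
by rewrite (Derive_n_slide _ oV sf Vs).
Qed.

Lemma taylor_lagrange_coord V f j c x N : is_open V -> smooth_on V f ->
  (forall t, 0 <= t <= 1 -> V (slide j c t x)) ->
  exists t, 0 < t < 1 /\
    f x = \big[Rplus/0]_(0 <= k < N.+1)
            ((x j - c) ^ k / INR (fact k) * pdn k j f (upd x j c)) +
          (x j - c) ^ N.+1 / INR (fact N.+1) * pdn N.+1 j f (slide j c t x).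
Proof.
move=> oV sf Vx.
have [|t t01 k _|t [t01 fx]] := @Taylor_Lagrange (fun s => f (slide j c s x)) N 0 1.
- exact: Rlt_0_1.
- exact: ex_derive_n_slide oV sf (Vx t t01).
exists t; split=> //; move: fx; rewrite slide1 sum_f_R0E => ->.
rewrite (Derive_n_slide N.+1 oV sf (Vx t _)) ?Rminus_0_r ?pow1; last lra.
congr Rplus; last by rewrite /Rdiv; ring.
apply: eq_bigr => k _; rewrite (Derive_n_slide k oV sf (Vx 0 _)) ?slide0 ?pow1; last lra.
by rewrite /Rdiv; ring.
Qed.

Definition bigO_at0 N g := exists C,
  at_right 0 (fun r => forall x, (forall i, Rabs (x i) <= r) -> Rabs (g x) <= C * r ^ N).

Lemma bigO_at0_plus N f g : bigO_at0 N f -> bigO_at0 N g ->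
  bigO_at0 N (fun x => f x + g x).
Proof.
move=> [C fC] [D gD]; exists (C + D).
apply: filter_imp (filter_and _ _ fC gD) => r [{}fC {}gD] x xr.
rewrite Rmult_plus_distr_r; apply: Rle_trans (Rabs_triang _ _) _.
by apply: Rplus_le_compat; [exact: fC|exact: gD].
Qed.

Lemma bigO_at0_mult M N f g : bigO_at0 M f -> bigO_at0 N g ->
  bigO_at0 (M + N) (fun x => f x * g x).
Proof.
move=> [C fC] [D gD]; exists (C * D).
apply: filter_imp (filter_and _ _ fC gD) => r [{}fC {}gD] x xr.
rewrite Rabs_mult pow_add (_ : _ * _ * _ = C * r ^ M * (D * r ^ N)); last ring.
by apply: Rmult_le_compat; [exact: Rabs_pos|exact: Rabs_pos|exact: fC|exact: gD].
Qed.

Lemma bigO_at0_0 N : bigO_at0 N (fun _ => 0).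
Proof.
exists 0; apply: filter_imp (at_right_gt 0) => r r0 x _.
by rewrite Rabs_R0 Rmult_0_l; lra.
Qed.

Lemma bigO_at0_ext N f g : (forall x, f x = g x) -> bigO_at0 N f -> bigO_at0 N g.
Proof. by move=> fg [C fC]; exists C; apply: filter_imp fC => r fC x /fC; rewrite fg. Qed.

Lemma bigO_at0_sum N (I : Type) (r : seq I) (F : I -> vec n -> R) :
  (forall k : I, bigO_at0 N (F k)) -> bigO_at0 N (fun x => \big[Rplus/0]_(k <- r) F k x).
Proof.
move=> FO; elim: r => [|k r IH].
  by apply: bigO_at0_ext (bigO_at0_0 N) => x; rewrite big_nil.
by apply: bigO_at0_ext (bigO_at0_plus (FO k) IH) => x; rewrite big_cons.
Qed.

Lemma bigO_at0_shrink N g (phi : vec n -> vec n) :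
  (forall x i, Rabs (phi x i) <= Rabs (x i)) -> bigO_at0 N g ->
  bigO_at0 N (fun x => g (phi x)).
Proof.
move=> phi_le [C gC]; exists C; apply: filter_imp gC => r gC x xr.
by apply: gC => i; apply: Rle_trans (phi_le x i) (xr i).
Qed.

Lemma at_right_locally0 (P : vec n -> Prop) : locally (zero n) P ->
  at_right 0 (fun r => forall x, (forall i, Rabs (x i) <= r) -> P x).
Proof.
move=> [d Pd]; exists d => r rd r0 x xr; apply: Pd => i.
change (Rabs (x i - 0) < d); change (Rabs (r - 0) < d) in rd.
by have := xr i; move: rd; split_Rabs; lra.
Qed.

Lemma bigO_at0_continuous g : continuous g (zero n) -> bigO_at0 0 g.
Proof.
move=> /filterlim_locally/(_ (mkposreal _ Rlt_0_1)) g1.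
exists (Rabs (g (zero n)) + 1); apply: filter_imp (at_right_locally0 g1) => r {}g1 x /g1 gx.
have {}gx : Rabs (g x - g (zero n)) < 1 := gx.
by rewrite Rmult_1_r; split_Rabs; lra.
Qed.

Lemma slide_shrink j t x i : 0 <= t <= 1 -> Rabs (slide j 0 t x i) <= Rabs (x i).
Proof.
move=> t01; rewrite /slide /upd; case: eqP => [->|_]; last exact: Rle_refl.
rewrite Rplus_0_l Rminus_0_r Rabs_mult (Rabs_pos_eq t); last lra.
by have := Rabs_pos (x j); nra.
Qed.

Lemma bigO_at0_taylor_coord V f j N : is_open V -> V (zero n) -> smooth_on V f ->
  bigO_at0 N.+1 (fun x => f x -
    \big[Rplus/0]_(0 <= k < N.+1) (x j ^ k / INR (fact k) * pdn k j f (upd x j 0))).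
Proof.
move=> oV V0 sf; set g := pdn N.+1 j f.
have cg : continuous g (zero n).
  by apply: (cont_on_continuous oV _ V0); exact: (smooth_pdn j N.+1 oV sf 0%N).
have [K gK] := bigO_at0_continuous cg.
exists (K / INR (fact N.+1)).
have Vloc := at_right_locally0 (is_open_locally oV V0).
apply: filter_imp (filter_and _ _ Vloc gK) => r [Vr {}gK] x xr.
have slide_r t i : 0 <= t <= 1 -> Rabs (slide j 0 t x i) <= r.
  by move=> t01; exact: Rle_trans (slide_shrink j x i t01) (xr i).
have [|t [t01 ->]] := @taylor_lagrange_coord V f j 0 x N oV sf.
  by move=> t t01; apply: Vr => i; exact: slide_r.
rewrite Rminus_0_r -/g; set T := \big[Rplus/0]_(_ <= _ < _) _.
rewrite (_ : T + _ - T = x j ^ N.+1 * (g (slide j 0 t x) / INR (fact N.+1)));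
  last by rewrite /Rdiv; ring.
have fact0 := lt_0_INR _ (lt_O_fact N.+1).
rewrite Rabs_mult -RPow_abs Rmult_comm Rabs_div; last lra.
rewrite (Rabs_pos_eq (INR _)); last lra.
apply: Rmult_le_compat.
- by apply: Rdiv_le_0_compat => //; exact: Rabs_pos.
- exact/pow_le/Rabs_pos.
- apply: Rmult_le_compat_r; first exact/Rlt_le/Rinv_0_lt_compat.
  by rewrite -[K]Rmult_1_r; apply: gK => i; apply: slide_r; lra.
- by apply: pow_incr; split; [exact: Rabs_pos|exact: xr].
Qed.

(* Expanding one coordinate after the other produces the partial derivatives in the order
   of [mlist], so no symmetry of mixed derivatives is needed. *)
Fixpoint taylor_poly N js f x : R :=
  if js is j :: js' then
    \big[Rplus/0]_(0 <= k < N) (x j ^ k / INR (fact k) * taylor_poly N js' (pdn k j f) x)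
  else f (zero n).

Definition restrict js x : vec n := fun i => if i \in js then x i else 0.

Lemma restrict_le js x i : Rabs (restrict js x i) <= Rabs (x i).
Proof.
rewrite /restrict; case: ifP => _; first exact: Rle_refl.
by rewrite Rabs_R0; exact: Rabs_pos.
Qed.

Lemma restrict_enum x : restrict (enum 'I_n) x = x.
Proof. by apply: functional_extensionality => i; rewrite /restrict mem_enum. Qed.

Lemma upd_restrict_cons j js x : j \notin js ->
  upd (restrict (j :: js) x) j 0 = restrict js x.
Proof.
move=> jjs; apply: functional_extensionality => i; rewrite /upd /restrict in_cons.
by case: eqP => // ->; rewrite (negbTE jjs).
Qed.

Lemma bigO_at0_taylor_poly V f js N : is_open V -> V (zero n) -> smooth_on V f -> uniq js ->
  bigO_at0 N.+1 (fun x => f (restrict js x) - taylor_poly N.+1 js f x).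
Proof.
move=> oV V0; elim: js f => [|j js IH] f sf.
  by move=> _; apply: bigO_at0_ext (bigO_at0_0 _) => x; rewrite /= Rminus_diag.
move=> /= /andP [jjs us].
have coord_term k : bigO_at0 N.+1 (fun x => x j ^ k / INR (fact k) *
    (pdn k j f (restrict js x) - taylor_poly N.+1 js (pdn k j f) x)).
  apply: (bigO_at0_mult (M := 0)); last exact: IH (smooth_pdn j k oV sf) us.
  apply/bigO_at0_continuous/(Ck_continuous (k := 0) (V := fun _ => True)) => //.
    exact: is_open_true.
  by apply: Ck_mult; [apply/Ck_pow/Ck_coord|exact: Ck_const].
have coord_sum := bigO_at0_sum (index_iota 0 N.+1) coord_term.
have first_coord := bigO_at0_shrink (restrict_le (j :: js)) (bigO_at0_taylor_coord j N oV V0 sf).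
apply: bigO_at0_ext (bigO_at0_plus first_coord coord_sum) => x.
have xj : restrict (j :: js) x j = x j by rewrite /restrict mem_head.
have -> : \big[Rplus/0]_(0 <= k < N.+1) (x j ^ k / INR (fact k) *
    (pdn k j f (restrict js x) - taylor_poly N.+1 js (pdn k j f) x)) =
    \big[Rplus/0]_(0 <= k < N.+1) (x j ^ k / INR (fact k) * pdn k j f (restrict js x)) +
    -1 * taylor_poly N.+1 (j :: js) f x.
  by rewrite /= big_distrr -big_split; apply: eq_bigr => k _; rewrite /=; ring.
by rewrite upd_restrict_cons // xj /=; ring.
Qed.

Fixpoint exponents N js : seq {ffun 'I_n -> nat} :=
  if js is j :: js' then
    [seq [ffun i => if i == j then k else e i] | k <- index_iota 0 N, e <- exponents N js']
  else [:: [ffun=> 0%N]].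

Lemma exponents_support N js e i :
  e \in exponents N js -> i \notin js -> e i = 0%N.
Proof.
elim: js e => [|j js IH] e /=; first by rewrite inE => /eqP -> _; rewrite ffunE.
case/allpairsP => -[k d] /= [_ d_in ->]; rewrite in_cons negb_or ffunE => /andP [/negbTE ->].
exact: IH.
Qed.

Lemma uniq_exponents N js : uniq js -> uniq (exponents N js).
Proof.
elim: js => [|j js IH] //= /andP [jjs us].
apply: allpairs_uniq; [exact: iota_uniq|exact: IH|].
move=> _ _ /allpairsP [[k e] /= [_ e_in ->]] /allpairsP [[l d] /= [_ d_in ->]] /ffunP kl.
have := kl j; rewrite !ffunE eqxx => <-; congr pair; apply/ffunP => i.
have := kl i; rewrite !ffunE; case: eqP => // -> _.
by rewrite (exponents_support e_in) // (exponents_support d_in).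
Qed.

Lemma mem_exponents N js e : uniq js ->
  (forall i, i \in js -> (e i < N)%N) -> (forall i, i \notin js -> e i = 0%N) ->
  e \in exponents N js.
Proof.
elim: js e => [|j js IH] e /= us eN e0.
  by rewrite inE; apply/eqP/ffunP => i; rewrite ffunE e0.
have [jjs {}us] := andP us.
apply/allpairsP; exists (e j, [ffun i => if i == j then 0%N else e i]); split=> /=.
- by rewrite mem_index_iota eN // mem_head.
- apply: IH => // i; rewrite ffunE; case: eqP => [->|/eqP ij] ijs //.
  + by rewrite ijs in jjs.
  + by apply: eN; rewrite in_cons ijs orbT.
  + by apply: e0; rewrite in_cons negb_or ij.
- by apply/ffunP => i; rewrite !ffunE; case: eqP => // ->.
Qed.

Definition pds js f := foldl (fun g j => pd g j) f js.

Definition taylor f al : R := pds (mlist al) f (zero n) / fact_m al.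

Lemma pds_cat_nseq k j js f : pds (nseq k j ++ js) f = pds js (pdn k j f).
Proof.
rewrite /pds foldl_cat; congr foldl.
by elim: k f => [|k IH] f //=; rewrite IH /pdn -iterSr.
Qed.

Lemma taylor_poly_exponents N js f x : uniq js ->
  taylor_poly N js f x = \big[Rplus/0]_(e <- exponents N js)
    (pds (flatten [seq nseq (e i) i | i <- js]) f (zero n) *
     \big[Rmult/1]_(i <- js) (x i ^ e i / INR (fact (e i)))).
Proof.
elim: js f => [|j js IH] f; first by rewrite big_seq1 /= big_nil Rmult_1_r.
move=> /= /andP [jjs us]; rewrite big_allpairs_dep; apply: eq_bigr => k _.
rewrite IH // big_distrr; apply: eq_bigr => e _ /=.
set d := [ffun i => _]; have dj : d j = k by rewrite ffunE eqxx.
have de i : i \in js -> d i = e i.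
  by rewrite ffunE; case: eqP => // ->; rewrite (negbTE jjs).
have -> : [seq nseq (d i) i | i <- js] = [seq nseq (e i) i | i <- js].
  by apply/eq_in_map => i /de ->.
rewrite big_cons dj pds_cat_nseq.
have -> : \big[Rmult/1]_(i <- js) (x i ^ d i / INR (fact (d i))) =
    \big[Rmult/1]_(i <- js) (x i ^ e i / INR (fact (e i))).
  by rewrite big_seq [RHS]big_seq; apply: eq_bigr => i /de ->.
by rewrite /=; ring.
Qed.

Lemma taylor_polyE N f x : taylor_poly N (enum 'I_n) f x =
  \big[Rplus/0]_(e <- exponents N (enum 'I_n)) (taylor f e * mono e x).
Proof.
rewrite taylor_poly_exponents ?enum_uniq //; apply: eq_bigr => e _.
have -> : \big[Rmult/1]_(i <- enum 'I_n) (x i ^ e i / INR (fact (e i))) = mono e x / fact_m e.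
  by rewrite big_enum big_split /= -(big_morph Rinv Rinv_mult Rinv_1).
by rewrite /taylor /mlist /Rdiv; ring.
Qed.

End Taylor.

Section TaylorCoefficients.
Variables (n : nat) (V : vec n -> Prop).
Hypotheses (oV : is_open V) (V0 : V (zero n)).
Implicit Types (x : vec n) (f g h : vec n -> R) (j : 'I_n) (js : seq 'I_n) (al : mindex n).

Lemma pds_ext js f g x : (forall y, V y -> f y = g y) -> V x -> pds js f x = pds js g x.
Proof.
elim: js f g x => [|j js IH] f g x fg Vx; first exact: fg.
apply: IH Vx => y Vy; apply: Derive_ext_loc.
exact: locally_upd (eq_on_open_locally oV Vy fg).
Qed.

Lemma iter_partial_pds js f h x : iter_partial V js f h -> V x -> h x = pds js f x.
Proof.
move=> fh; elim: fh x => {js f h} [//|j js f g h Dg _ IH] x Vx.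
by rewrite IH //; apply: pds_ext => // y /Dg /has_partial_unique.
Qed.

Lemma smooth_iter_partial js f : smooth_on V f -> iter_partial V js f (pds js f).
Proof.
elim: js f => [|j js IH] f sf; first exact: ip_nil.
apply: (ip_cons (g := pd f j)); last exact/IH/smooth_pd.
by move=> x; exact: Ck1_has_partial (sf 1%N).
Qed.

Lemma taylor_coefE f al c : smooth_on V f -> taylor_coef V f al c <-> c = taylor f al.
Proof.
move=> sf; split=> [[h [fh ->]]|->]; first by rewrite (iter_partial_pds fh V0).
by exists (pds (mlist al) f); split; first exact: smooth_iter_partial.
Qed.

Lemma in_suppE f al : smooth_on V f -> in_supp V f al <-> taylor f al <> 0.
Proof.
move=> sf; split=> [[c [/(taylor_coefE _ _ sf) ->]] //|c0].
by exists (taylor f al); split=> //; apply/taylor_coefE.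
Qed.

End TaylorCoefficients.

Section LinearForms.
Variable n : nat.
Implicit Types (x y b c : vec n) (w al : mindex n) (i j : 'I_n).

Definition dotn w al : nat := (\sum_(k < n) w k * al k)%N.

Lemma dotR_natv w al : dotR (natv w) (natv al) = INR (dotn w al).
Proof. by rewrite /dotn INR_sum; apply: eq_bigr => k _; rewrite /natv -mult_INR. Qed.

Lemma Zv_natZ w : Zv (natZ w) = natv w.
Proof. by apply: functional_extensionality => i; rewrite /Zv /natZ -INR_IZR_INZ. Qed.

Lemma natv_ge0 w i : 0 <= natv w i.
Proof. exact: pos_INR. Qed.

Lemma dotR_le b x y : (forall i, 0 <= b i) -> (forall i, x i <= y i) -> dotR b x <= dotR b y.
Proof. by move=> b0 xy; apply: Rsum_le => i _; exact: Rmult_le_compat_l. Qed.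

Lemma dotRDZr b x y (t : R) : dotR b (fun i => x i + t * y i) = dotR b x + t * dotR b y.
Proof. by rewrite /dotR big_distrr -big_split; apply: eq_bigr => i _ /=; ring. Qed.

Lemma dotR_sumr b (T : Type) (r : seq T) (lam : T -> R) (v : T -> vec n) :
  dotR b (fun i => \big[Rplus/0]_(q <- r) (lam q * v q i)) =
  \big[Rplus/0]_(q <- r) (lam q * dotR b (v q)).
Proof.
rewrite /dotR (eq_bigr (fun i => \big[Rplus/0]_(q <- r) (b i * (lam q * v q i)))).
  by rewrite exchange_big /=; apply: eq_bigr => q _; rewrite big_distrr;
    apply: eq_bigr => i _ /=; ring.
by move=> i _; rewrite big_distrr.
Qed.

Lemma continuous_dotRl x b : continuous (fun b => dotR b x) b.
Proof.
apply: (Ck_continuous (k := 0) (V := fun _ => True)) => //; first exact: is_open_true.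
by apply: Ck_sum => i; apply: Ck_mult; [exact: Ck_coord|exact: Ck_const].
Qed.

Lemma coord_le_dotn w al i : (forall i, (0 < w i)%N) -> (al i <= dotn w al)%N.
Proof.
move=> w0; rewrite /dotn (bigD1 i) //=; apply: leq_trans (leq_addr _ _).
exact: leq_pmull.
Qed.

Lemma coord_le_dotR w x i : (forall i, (0 < w i)%N) -> (forall i, 0 <= x i) ->
  x i <= dotR (natv w) x.
Proof.
move=> w0 x0; have wx0 k : 0 <= natv w k * x k by exact: Rmult_le_pos (natv_ge0 w k) (x0 k).
apply: Rle_trans _ (term_le_Rsum i wx0).
rewrite -[X in X <= _]Rmult_1_l; apply: Rmult_le_compat_r => //.
by rewrite -[1]/(INR 1); apply/le_INR/ltP.
Qed.

End LinearForms.

Section WeightedScaling.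
Variable n : nat.
Implicit Types (x : vec n) (g : vec n -> R) (w al : mindex n) (i k : 'I_n) (l : nat).

Lemma mono_tpow w al t x : mono al (tpow w t x) = t ^ dotn w al * mono al x.
Proof.
rewrite /dotn (big_morph (pow t) (id2 := 0%N) (pow_add t) erefl) /mono -big_split.
by apply: eq_bigr => i _; rewrite /tpow Rpow_mult_distr -pow_mult.
Qed.

Lemma tpow_le w t x M i : 0 < t < 1 -> (0 < w i)%N -> Rabs (x i) <= M ->
  Rabs (tpow w t x i) <= t * M.
Proof.
move=> t01 wi xM; rewrite /tpow Rabs_mult Rabs_pos_eq; last by apply: pow_le; lra.
apply: Rmult_le_compat => //; [by apply: pow_le; lra|exact: Rabs_pos|].
case: (w i) wi => // k _; rewrite -[X in _ <= X]Rmult_1_r /=.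
apply: Rmult_le_compat_l; first lra.
by rewrite -(pow1 k); apply: pow_incr; lra.
Qed.

Lemma tpow0 w x : (forall k, (0 < w k)%N) -> tpow w 0 x = zero n.
Proof.
move=> w0; apply: functional_extensionality => k.
by rewrite /tpow pow_i ?Rmult_0_l //; exact/ltP.
Qed.

Lemma filterlim_bigO_tpow g w l x : (forall i, (0 < w i)%N) -> bigO_at0 l.+1 g ->
  filterlim (fun t => g (tpow w t x) / t ^ l) (at_right 0) (locally 0).
Proof.
move=> w0 [C gC]; pose M := 1 + \big[Rplus/0]_(i < n) Rabs (x i).
have M0 : 0 < M.
  by apply: Rplus_lt_le_0_compat; [lra|apply: Rsum_ge0 => i _; exact: Rabs_pos].
have xM i : Rabs (x i) <= M.
  have xi_le : Rabs (x i) <= \big[Rplus/0]_(k < n) Rabs (x k).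
    exact: (term_le_Rsum i (fun k => Rabs_pos (x k))).
  by rewrite /M; lra.
have gM : at_right 0 (fun t => forall y, (forall i, Rabs (y i) <= t * M) ->
    Rabs (g y) <= C * (t * M) ^ l.+1) := filterlim_scale_at_right0 M0 gC.
have below1 : at_right 0 (fun t => t < 1).
  exact: filter_le_within (open_lt 1 0 Rlt_0_1).
apply: (filterlim_squeeze0 (g := fun t => C * M ^ l.+1 * t ^ 1)); last first.
  rewrite -[X in locally X](Rmult_0_r (C * M ^ l.+1)).
  exact: filterlim_Rmult (filterlim_const _) (filterlim_pow_at_right0 0).
apply: filter_imp (filter_and _ _ (at_right_gt 0) (filter_and _ _ below1 gM)) => t.
move=> [t0 [t1 gt]]; have tl := pow_lt t l t0.
rewrite Rabs_div; last lra.
rewrite (Rabs_pos_eq (t ^ l)); last lra.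
apply: (Rmult_le_reg_r (t ^ l)) => //.
rewrite (_ : Rabs _ / _ * _ = Rabs (g (tpow w t x))); last by field; lra.
rewrite (_ : _ * t ^ 1 * _ = C * (t * M) ^ l.+1); last by rewrite Rpow_mult_distr /=; ring.
by apply: gt => i; apply: tpow_le.
Qed.

Lemma filterlim_monomial_tpow (c : R) w l al x : (c <> 0 -> (l <= dotn w al)%N) ->
  filterlim (fun t => c * mono al (tpow w t x) / t ^ l) (at_right 0)
    (locally (if dotn w al == l then c * mono al x else 0)).
Proof.
have [->|/eqP c0] := eqVneq c 0.
  move=> _; rewrite Rmult_0_l if_same.
  by apply: filterlim_ext (filterlim_const 0) => t; rewrite Rmult_0_l /Rdiv Rmult_0_l.
move=> /(_ c0) l_le; have [al_l|al_l] := eqVneq (dotn w al) l.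
  apply: filterlim_ext_loc (filterlim_const (c * mono al x)).
  apply: filter_imp (at_right_gt 0) => t t0; have tl := pow_nonzero t l (Rgt_not_eq _ _ t0).
  by rewrite mono_tpow al_l (_ : c * _ / _ = c * mono al x) //; field.
have l_lt : (l < dotn w al)%N by rewrite ltn_neqAle eq_sym al_l l_le.
pose k := (dotn w al - l.+1)%N.
rewrite -[X in locally X](Rmult_0_r (c * mono al x)).
apply: filterlim_ext_loc
  (filterlim_Rmult (filterlim_const (c * mono al x)) (filterlim_pow_at_right0 k)).
apply: filter_imp (at_right_gt 0) => t t0.
rewrite mono_tpow -(subnKC l_lt) -/k pow_add /=; field.
by apply: pow_nonzero; lra.
Qed.

End WeightedScaling.

Section NewtonPolyhedron.
Variables (n : nat) (V : vec n -> Prop) (f : vec n -> R).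
Implicit Types (x y b : vec n) (P g : vec n -> Prop) (w al : mindex n) (i : 'I_n).

Lemma supp_Newton al : in_supp V f al -> Newton V f (natv al).
Proof.
move=> sal; exists [:: (1, al, natv al)]; split.
  by move=> q /= [<-|//] /=; split; [lra|split=> // i; exact: Rle_refl].
by split=> [|i] /=; rewrite /natv; ring.
Qed.

Lemma Newton_dotR_gt b m x : (forall i, 0 <= b i) ->
  (forall al, in_supp V f al -> m < dotR b (natv al)) -> Newton V f x -> m < dotR b x.
Proof.
move=> b0 m_lt [l [l_hull [sum1 xE]]]; rewrite fold_right_Rplus in sum1.
have -> : x = fun i => \big[Rplus/0]_(q <- l) (q.1.1 * q.2 i).
  by apply: functional_extensionality => i; rewrite xE fold_right_Rplus.
rewrite dotR_sumr -[m]Rmult_1_r -sum1.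
apply: convex_comb_gt => [q /l_hull [] //|q /l_hull [_ [/m_lt supp_q q2]]|].
  exact: Rlt_le_trans supp_q (dotR_le b0 q2).
by rewrite sum1; lra.
Qed.

Lemma Newton_ge0 x i : Newton V f x -> 0 <= x i.
Proof.
move=> [l [l_hull [_ ->]]]; elim: l l_hull => [|q l IH] l_hull /=; first lra.
have [q0 [_ qi]] := l_hull q (or_introl erefl).
apply: Rplus_le_le_0_compat; last by apply: IH => q' hq; apply: l_hull; right.
exact: Rmult_le_pos q0 (Rle_trans _ _ _ (pos_INR _) (qi i)).
Qed.

Lemma lmin_Newton_supp b m : (forall i, 0 <= b i) -> lmin (Newton V f) b m ->
  exists al, in_supp V f al /\ dotR b (natv al) = m.
Proof.
move=> b0 [[x [Px xm]] m_le]; apply: NNPP => not_attained.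
suff : m < dotR b x by lra.
apply: Newton_dotR_gt Px => // al sal.
have := m_le _ (supp_Newton sal).
by case=> // E; case: not_attained; exists al.
Qed.

Lemma closure_dual_cone_le P g b x y :
  closure (dual_cone P g) b -> g x -> P y -> dotR b x <= dotR b y.
Proof.
move=> cb gx Py; apply: Rnot_lt_le => y_lt_x.
have gap_cont : continuous (fun c => dotR c y + -1 * dotR c x) b.
  apply: filterlim_Rplus; first exact: continuous_dotRl.
  by apply: filterlim_Rmult; [exact: filterlim_const|exact: continuous_dotRl].
have gap_neg : dotR b y + -1 * dotR b x < 0 by lra.
have [d near_neg] := gap_cont _ (open_lt 0 _ gap_neg).
have [c [[c0 [m [[_ m_le] gP]]] bc]] := cb d (cond_pos d).
have cy_lt : dotR c y + -1 * dotR c x < 0 := near_neg c bc.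
by have [_ cx] := proj2 (gP x) gx; have := m_le y Py; lra.
Qed.

Definition face w (l : nat) x := Newton V f x /\ dotR (natv w) x = INR l.

Lemma face_defines w l : defines (Newton V f) (natZ w) (Z.of_nat l) (face w l).
Proof. by move=> x; rewrite Zv_natZ -INR_IZR_INZ. Qed.

Lemma lmin_valid w l : lmin (Newton V f) (natv w) (INR l) ->
  valid (Newton V f) (natZ w) (Z.of_nat l).
Proof. by move=> [_ l_le] x /l_le; rewrite Zv_natZ -INR_IZR_INZ. Qed.

Lemma lmin_face w l : lmin (Newton V f) (natv w) (INR l) -> is_face (Newton V f) (face w l).
Proof.
move=> wl; exists (natZ w), (Z.of_nat l).
by split; [exact: lmin_valid|exact: face_defines].
Qed.

Lemma lmin_compact_face w l : (forall i, (0 < w i)%N) ->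
  lmin (Newton V f) (natv w) (INR l) -> compact_face (Newton V f) (face w l).
Proof.
move=> w0 wl; split; first exact: lmin_face.
split; first by have [[x [Px xl]] _] := wl; exists x.
exists (INR l) => x [Px <-] i; rewrite Rabs_pos_eq; last exact: Newton_ge0 Px.
by apply: coord_le_dotR => // k; exact: Newton_ge0 Px.
Qed.

End NewtonPolyhedron.

Section FacePart.
Variable n : nat.
Implicit Types (x : vec n) (f g : vec n -> R) (w al : mindex n) (e : {ffun 'I_n -> nat}).
Implicit Types (i : 'I_n) (l : nat).

(* The multi-indices with all entries at most [l] contain every [e] with
   [dotn w e = l] as soon as [w] is positive. *)
Definition face_poly f w l x : R :=
  \big[Rplus/0]_(e <- exponents l.+1 (enum 'I_n) | dotn w e == l) (taylor f e * mono e x).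

Definition face_list f w l : list (mindex n * R) :=
  [seq (e : mindex n, taylor f e) |
    e <- exponents l.+1 (enum 'I_n) & (dotn w e == l) && (taylor f e != 0)].

Lemma poly_ofE (S : list (mindex n * R)) x :
  poly_of S x = \big[Rplus/0]_(p <- S) (p.2 * mono p.1 x).
Proof. exact: fold_right_Rplus. Qed.

Lemma Ck_poly_of k V (S : list (mindex n * R)) : Ck k V (poly_of S).
Proof.
have -> : poly_of S = fun x => \big[Rplus/0]_(p <- S) (p.2 * mono p.1 x).
  by apply: functional_extensionality => x; exact: poly_ofE.
by apply: Ck_sum => p; apply: Ck_mult; [exact: Ck_const|exact: Ck_mono].
Qed.

Lemma poly_of_face_list f w l x : poly_of (face_list f w l) x = face_poly f w l x.
Proof.
rewrite poly_ofE big_map big_filter /face_poly big_mkcondr; apply: eq_bigr => e _ /=.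
by case: eqP => [->|_] /=; rewrite ?Rmult_0_l.
Qed.

Lemma mem_face_exponents w l e : (forall i, (0 < w i)%N) -> dotn w e = l ->
  e \in exponents l.+1 (enum 'I_n).
Proof.
move=> w0 el; apply: mem_exponents => [|i _|i]; first exact: enum_uniq.
- by rewrite ltnS -el coord_le_dotn.
- by rewrite mem_enum.
Qed.

Lemma finfun_mindex al : (finfun al : mindex n) = al.
Proof. by apply: functional_extensionality => i; rewrite ffunE. Qed.

Variables (U : vec n -> Prop) (f : vec n -> R).
Hypotheses (oU : is_open U) (U0 : U (zero n)) (sf : smooth_on U f).

Lemma gamma_part_face_list w l : (forall i, (0 < w i)%N) ->
  gamma_part_list U f (face U f w l) (face_list f w l).
Proof.
move=> w0; split; [|split].
- rewrite -map_comp; apply: NoDup_map_NoDup_ForallPairs; last first.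
    exact/uniq_NoDup/filter_uniq/uniq_exponents/enum_uniq.
  by move=> e d _ _ /= ed; apply/ffunP => i; rewrite ed.
- move=> _ /in_map_iff [e [<- /In_memP]]; rewrite mem_filter => /andP [/andP [/eqP el /eqP c0] _].
  split; first exact/taylor_coefE.
  by split; [exact/supp_Newton/(in_suppE oU U0)|rewrite dotR_natv el].
- move=> al [_]; rewrite dotR_natv => /INR_eq al_l /(in_suppE oU U0 _ sf) /eqP c0.
  rewrite -map_comp; apply/in_map_iff; exists (finfun al); split; first exact: finfun_mindex.
  apply/In_memP; rewrite mem_filter (mem_face_exponents w0) finfun_mindex ?al_l //.
  by rewrite eqxx c0.
Qed.

Lemma face_poly_vertex w l al x : (forall i, (0 < w i)%N) -> dotn w al = l ->
  (forall be, in_supp U f be -> dotn w be = l -> be = al) ->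
  face_poly f w l x = taylor f al * mono al x.
Proof.
move=> w0 al_l only_al.
have al_in := mem_face_exponents w0 (etrans (congr1 (dotn w) (finfun_mindex al)) al_l).
rewrite /face_poly big_mkcond (bigD1_seq (finfun al)) ?uniq_exponents ?enum_uniq //=.
rewrite finfun_mindex al_l eqxx big1_seq ?Rplus_0_r // => e /andP [/eqP e_al _].
case: eqP => // el; have [->|/eqP c0] := eqVneq (taylor f e) 0; first by rewrite Rmult_0_l.
case: e_al; rewrite -(only_al e _ el); last exact/(in_suppE oU U0).
by apply/ffunP => i; rewrite ffunE.
Qed.

Lemma face_poly_limit w l x : (forall i, (0 < w i)%N) ->
  (forall al, in_supp U f al -> (l <= dotn w al)%N) ->
  filterlim (fun t => f (tpow w t x) / t ^ l) (at_right 0) (locally (face_poly f w l x)).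
Proof.
move=> w0 l_min; pose r y := f (restrict (enum 'I_n) y) - taylor_poly l.+1 (enum 'I_n) f y.
have r_lim : filterlim (fun t => r (tpow w t x) / t ^ l) (at_right 0) (locally 0).
  by apply: filterlim_bigO_tpow => //; apply: bigO_at0_taylor_poly oU U0 sf (enum_uniq _).
rewrite /face_poly big_mkcond -[X in locally X]Rplus_0_r.
have term_lim e : filterlim (fun t => taylor f e * mono e (tpow w t x) / t ^ l) (at_right 0)
    (locally (if dotn w e == l then taylor f e * mono e x else 0)).
  by apply: filterlim_monomial_tpow => c0; exact/l_min/(in_suppE oU U0).
apply: filterlim_ext (filterlim_Rplus (filterlim_Rsum term_lim) r_lim) => t.
by rewrite /r restrict_enum taylor_polyE -big_distrl /= /Rdiv; ring.
Qed.

End FacePart.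

Section Cones.
Variable n : nat.
Implicit Types (x b c : vec n) (S : list (mindex n)) (a : 'I_n -> mindex n) (i j k : 'I_n).

Lemma zero_in_cone S : in_cone S (zero n).
Proof.
exists (map (fun _ => 0) S); split; first exact: length_map.
split; first by apply/Forall_forall => _ /in_map_iff [p [<- _]]; lra.
by move=> i; elim: S => [//|p S IH] /=; rewrite -IH /zero; ring.
Qed.

Lemma skeleton_in_cone a j : in_cone (map a (enum 'I_n)) (natv (a j)).
Proof.
exists [seq (if i == j then 1 else 0) | i <- enum 'I_n]; split; first by rewrite !length_map.
split; first by apply/Forall_forall => t /in_map_iff [i [<- _]]; case: eqP => _; lra.
move=> k; rewrite combine_map -map_comp fold_right_Rplus big_enum /=.
by rewrite (big_indicator (fun i => INR (a i k))).
Qed.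

Lemma dotR_Zv_zlin (B : list ('I_n -> Z)) (ks : list Z) c :
  (forall v, In v B -> dotR (Zv v) c = 0) -> dotR (Zv (zlin B ks)) c = 0.
Proof.
elim: B ks => [|v B IH] [|q ks] Bc; try by apply: big1 => i _; rewrite /Zv Rmult_0_l.
rewrite /dotR (eq_bigr (fun i => IZR q * (Zv v i * c i) + Zv (zlin B ks) i * c i)).
  rewrite big_split -big_distrr /= -!/(dotR _ _) Bc ?IH => [|u uB|]; last by left.
    ring.
  by apply: Bc; right.
by move=> i _; rewrite /Zv /zlin /= plus_IZR mult_IZR; ring.
Qed.

Lemma Zbasis_separates (B : list ('I_n -> Z)) c : Zbasis B ->
  (forall v, In v B -> dotR (Zv v) c = 0) -> forall k, c k = 0.
Proof.
move=> [_ [span _]] Bc k.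
have [ks [_ ksE]] := span (fun i => if i == k then 1%Z else 0%Z).
rewrite -(big_indicator c k) -[RHS](dotR_Zv_zlin ks Bc); apply: eq_bigr => i _.
by rewrite /Zv ksE; case: eqP.
Qed.

Lemma subdivision_vertex U f Sig S :
  simplicial_subdivision (Newton U f) Sig -> Sig S ->
  exists al, in_supp U f al /\
    forall b, in_cone S b -> lmin (Newton U f) b (dotR b (natv al)).
Proof.
move=> [_ [sub _]] /sub [g [_ cone_g]].
have [b [[b0 [m [bm gE]]] _]] := cone_g _ (zero_in_cone S) 1 Rlt_0_1.
have [al [sal al_m]] := lmin_Newton_supp b0 bm.
exists al; split=> // c /cone_g cg; split.
  by exists (natv al); split=> //; exact: supp_Newton.
move=> x Px; apply: closure_dual_cone_le cg _ Px.
by apply/gE; split=> //; exact: supp_Newton.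
Qed.

End Cones.

Lemma mono_euler n (al : mindex n) (y : vec n) (j : 'I_n) :
  y j * pd (mono al) j y = INR (al j) * mono al y.
Proof.
pose rest := \big[Rmult/1]_(i < n | i != j) (y i ^ al i).
have mono_upd t : mono al (upd y j t) = rest * t ^ al j.
  rewrite /mono (bigD1 j) //= updE Rmult_comm; congr Rmult.
  by apply: eq_bigr => i ij; rewrite upd_neq.
rewrite /pd (Derive_ext _ (fun t => rest * t ^ al j)) //.
have -> : mono al y = rest * y j ^ al j by rewrite -mono_upd upd_id.
rewrite Derive_scal (is_derive_unique _ _ (INR (al j) * y j ^ (al j).-1)).
  by case: (al j) => [|k] /=; ring.
by apply/is_derive_Reals; exact: derivable_pt_lim_pow.
Qed.

Section MonomialMap.
Variables (n : nat) (a : 'I_n -> mindex n).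
Implicit Types (x y z : vec n) (U : vec n -> Prop) (f fs phi : vec n -> R) (i j k : 'I_n).
Implicit Types (al lv w : mindex n) (I : pred 'I_n).

Lemma Ck_pi p V k : Ck p V (fun y => pi a y k).
Proof. exact: (Ck_mono _ _ (a^~ k)). Qed.

Lemma continuous_pi y : continuous (pi a) y.
Proof.
apply: filterlim_vec => k.
exact: Ck_continuous (@is_open_true n) (Ck_pi 0 _ k) Logic.I.
Qed.

Lemma is_open_pi U : is_open U -> is_open (fun y => U (pi a y)).
Proof.
by move=> /is_openE oU; apply/is_openE; apply: open_comp oU => y _; exact: continuous_pi.
Qed.

Lemma pi_neq0 y k : (forall j, y j <> 0) -> pi a y k <> 0.
Proof.
move=> y0; rewrite /pi; elim/big_ind: _ => [|u v|j _]; first exact: R1_neq_R0.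
- exact: Rmult_integral_contrapositive_currified.
- exact/pow_nonzero/y0.
Qed.

Lemma pd_comp_pi phi y j : Ck 1 (fun _ => True) phi ->
  y j * pd (fun z => phi (pi a z)) j y =
  dotR (natv (a j)) (fun k => pi a y k * pd phi k (pi a y)).
Proof.
move=> Cphi; have oT := @is_open_true n.
have Dphi := @has_partial_comp _ _ _ _ (pi a) oT oT (fun _ _ => Logic.I) phi j y
  Cphi (fun k => Ck_pi 1 _ k) Logic.I.
rewrite (has_partial_unique Dphi) big_distrr; apply: eq_bigr => k _ /=.
have euler : y j * pd (fun z => pi a z k) j y = INR (a j k) * pi a y k.
  exact: (mono_euler (a^~ k)).
by rewrite -[RHS]Rmult_assoc -[natv _ _]/(INR (a j k)) -euler; ring.
Qed.

Definition scale I (t : R) z : vec n := fun j => if I j then t * z j else z j.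

Definition weight I : mindex n := fun k => (\sum_(j < n | I j) a j k)%N.

Definition level lv I : nat := (\sum_(j < n | I j) lv j)%N.

Lemma mono_scale al I t z : mono al (scale I t z) = t ^ level al I * mono al z.
Proof.
rewrite /level (big_morph (pow t) (id2 := 0%N) (pow_add t) erefl) big_mkcond -big_split.
apply: eq_bigr => j _; rewrite /scale /=.
by case: (I j); rewrite ?Rpow_mult_distr // Rmult_1_l.
Qed.

Lemma pi_scale I t z : pi a (scale I t z) = tpow (weight I) t (pi a z).
Proof. by apply: functional_extensionality => k; exact: (mono_scale (a^~ k)). Qed.

Lemma pi_upd j t s z : pi a (upd z j (t * s)) = tpow (a j) t (pi a (upd z j s)).
Proof.
have -> : a j = weight (pred1 j).
  by apply: functional_extensionality => k; rewrite /weight big_pred1_eq.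
rewrite -pi_scale; congr pi; apply: functional_extensionality => i.
by rewrite /scale /upd /=; case: eqP.
Qed.

Lemma weight_eq0 I j k : weight I k = 0%N -> I j -> a j k = 0%N.
Proof. by move/eqP; rewrite sum_nat_eq0 => /forallP /(_ j) /implyP Ij /Ij /eqP. Qed.

Lemma dotR_weight I x :
  dotR (natv (weight I)) x = \big[Rplus/0]_(j < n | I j) dotR (natv (a j)) x.
Proof.
rewrite /dotR exchange_big; apply: eq_bigr => k _.
by rewrite /natv /weight INR_sum big_distrl.
Qed.

Lemma dotn_weight I al : dotn (weight I) al = level (fun j => dotn (a j) al) I.
Proof.
rewrite /dotn /level exchange_big /=; apply: eq_bigr => k _.
by rewrite /weight big_distrl.
Qed.

Lemma filterlim_scale I z :
  filterlim (fun t => scale I t z) (at_right 0) (locally (scale I 0 z)).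
Proof.
apply: (filterlim_at_right (f := fun t => scale I t z)).
apply: filterlim_vec => j; rewrite /scale; case: (I j); last exact: filterlim_const.
by apply: filterlim_Rmult; [exact: filterlim_id|exact: filterlim_const].
Qed.

Lemma face_poly_pi U f fs lv I z : is_open U -> U (zero n) -> smooth_on U f ->
  cont_on (fun y => U (pi a y)) fs ->
  (forall y, U (pi a y) -> f (pi a y) = mono lv y * fs y) ->
  (forall k, (0 < weight I k)%N) ->
  (forall al, in_supp U f al -> (level lv I <= dotn (weight I) al)%N) ->
  face_poly f (weight I) (level lv I) (pi a z) = mono lv z * fs (scale I 0 z).
Proof.
move=> oU U0 sf cfs fE w0 lv_min.
have U_scale0 : U (pi a (scale I 0 z)) by rewrite pi_scale tpow0.
have cfs0 := cont_on_continuous (is_open_pi oU) cfs U_scale0.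
apply: (filterlim_locally_unique (F := at_right 0)
  (fun t => f (tpow (weight I) t (pi a z)) / t ^ level lv I)).
  exact: (face_poly_limit oU U0 sf w0 lv_min).
have fs_lim : filterlim (fun t => fs (scale I t z)) (at_right 0) (locally (fs (scale I 0 z))).
  by apply: filterlim_comp cfs0; exact: filterlim_scale.
apply: filterlim_ext_loc (filterlim_Rmult (filterlim_const (mono lv z)) fs_lim).
have U_scale : at_right 0 (fun t => U (pi a (scale I t z))) :=
  filterlim_scale (is_open_locally (is_open_pi oU) U_scale0).
apply: filter_imp (filter_and _ _ (at_right_gt 0) U_scale) => t [t0 Ut].
rewrite -pi_scale fE // mono_scale; field; apply: pow_nonzero; lra.
Qed.

Lemma hatE_wall_limit U f j l : is_open U -> hatE U f ->
  lmin (Newton U f) (natv (a j)) (INR l) ->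
  wall_limit (fun y => U (pi a y)) (fun y => f (pi a y)) j l.
Proof.
move=> oU [sf adm] lv_min y Uy yj _.
have := at_right_upd j (is_open_locally (is_open_pi oU) Uy); rewrite yj => Uupd.
have [s [s0 Us]] := filter_ex _ Uupd.
set x := pi a (upd y j s) in Us.
have [L limL] := adm _ (lmin_face lv_min) (a j) l (lmin_valid lv_min)
  (@face_defines _ _ _ _ _) x Us.
have g_lim : filterlim (fun t => f (tpow (a j) t x) / t ^ l) (at_right 0) (locally L).
  apply: limit1_in_at_right limL _.
  apply: filter_imp (filter_and _ _ (at_right_gt 0) (filterlim_scale_at_right0 s0 Uupd)) => t.
  by rewrite /x -pi_upd => -[t0 []].
exists (/ s ^ l * L).
have s1 := Rinv_0_lt_compat _ s0.
have g_rescaled := filterlim_comp _ _ _ _ _ _ _ _ (filterlim_scale_at_right0 s1) g_lim.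
apply: filterlim_ext_loc (filterlim_Rmult (filterlim_const (/ s ^ l)) g_rescaled).
apply: filter_imp (at_right_gt 0) => t t0.
rewrite /x -pi_upd Rpow_mult_distr pow_inv (_ : t * / s * s = t); last by field; lra.
by field; split; apply: pow_nonzero; lra.
Qed.

Lemma smooth_factor U f lv : is_open U -> hatE U f ->
  (forall j, lmin (Newton U f) (natv (a j)) (INR (lv j))) ->
  exists fs, smooth_on (fun y => U (pi a y)) fs /\
    forall y, U (pi a y) -> f (pi a y) = mono lv y * fs y.
Proof.
move=> oU fh lv_min; apply: smooth_div_mono => [|k|j]; first exact: is_open_pi.
- apply: (Ck_comp oU (is_open_pi oU)) => // [i|]; first exact: Ck_pi.
  by case: fh.
- exact: hatE_wall_limit.
Qed.

Lemma stratum_weight_gt0 I y k : T_I I y -> pi a y k = 0 -> (0 < weight I k)%N.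
Proof.
move=> TIy piy; rewrite lt0n; apply/eqP => wk; move: piy; rewrite /pi.
elim/big_ind: _ => [|u v u0 v0|j _]; first exact: R1_neq_R0.
- by move=> /Rmult_integral [].
- case Ij : (I j); first by rewrite (weight_eq0 wk Ij); exact: R1_neq_R0.
  by apply: pow_nonzero => /TIy; rewrite Ij.
Qed.

Lemma stratum_torus_lift U I y : is_open U -> T_I I y -> U (pi a y) ->
  exists z, (forall j, z j <> 0) /\ scale I 0 z = y /\ U (pi a z).
Proof.
move=> oU TIy Uy; pose lift t : vec n := fun j => if I j then t else y j.
have lift0 : lift 0 = y.
  by apply: functional_extensionality => j; rewrite /lift; case: ifP => // /TIy.
have lift_cont : continuous lift 0.
  apply: filterlim_vec => j; rewrite /lift.
  by case: (I j); [exact: filterlim_id|exact: filterlim_const].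
have := filterlim_at_right lift_cont; rewrite lift0 => lift_lim.
have U_lift := lift_lim _ (is_open_locally (is_open_pi oU) Uy).
have [t [t0 Ut]] := filter_ex _ (filter_and _ _ (at_right_gt 0) U_lift).
exists (lift t); split; [|split] => //.
- by move=> j; rewrite /lift; case Ij : (I j); [lra|move/TIy; rewrite Ij].
- apply: functional_extensionality => j; rewrite /scale /lift.
  by case Ij : (I j) => //; rewrite Rmult_0_l; apply/esym/TIy.
Qed.

Lemma has_partial_scale0 I h z j :
  (~~ I j -> has_partial h j (scale I 0 z) 0) ->
  has_partial (fun y => h (scale I 0 y)) j z 0.
Proof.
move=> Dh; apply/has_partialE; case Ij : (I j).
  apply: is_derive_ext (is_derive_const (h (scale I 0 z)) (z j)) => t; congr h.
  apply: functional_extensionality => i; rewrite /scale /upd.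
  by case: eqP => [->|//]; rewrite Ij !Rmult_0_l.
have zj : scale I 0 z j = z j by rewrite /scale Ij.
have /has_partialE := Dh (negbT Ij); rewrite zj; apply: is_derive_ext => t; congr h.
apply: functional_extensionality => i; rewrite /scale /upd.
by case: eqP => [->|//]; rewrite Ij.
Qed.

End MonomialMap.

Section Skeleton.
Variables (n : nat) (a : 'I_n -> mindex n).
Hypothesis comp : completable (map a (enum 'I_n)).

Lemma completable_skeleton_Zbasis : Zbasis (map (@natZ n \o a) (enum 'I_n)).
Proof.
have [T basis] := comp.
have T0 : T = [::].
  case: basis => sz _; apply: size0nil; move: sz.
  rewrite -[length _]/(size _) size_cat 2!size_map size_enum_ord => sz.
  by apply/eqP; rewrite -(eqn_add2l n) sz addn0.
by move: basis; rewrite T0 cats0 -map_comp.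
Qed.

Lemma skeleton_separates c : (forall j, dotR (natv (a j)) c = 0) -> forall k, c k = 0.
Proof.
move=> ac; apply: Zbasis_separates completable_skeleton_Zbasis _.
by move=> _ /in_map_iff [j [<- _]]; rewrite /= Zv_natZ.
Qed.

Lemma skeleton_positive k : exists j, (0 < a j k)%N.
Proof.
apply: NNPP => ak; pose c i := if i == k then 1 else 0.
suff ck : c k = 0 by move: ck; rewrite /c eqxx; lra.
apply: skeleton_separates => j; apply: big1 => i _; rewrite /c.
case: eqP => [->|_]; last by rewrite Rmult_0_r.
have /eqP ajk : a j k == 0%N by rewrite eqn0Ngt; apply/negP => ajk; apply: ak; exists j.
by rewrite /natv ajk Rmult_0_l.
Qed.

(* Off the coordinate hyperplanes [pi a] is a local diffeomorphism. *)
Lemma pi_critical phi z : Ck 1 (fun _ => True) phi -> (forall j, z j <> 0) ->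
  (forall j, pd (fun y => phi (pi a y)) j z = 0) -> forall k, pd phi k (pi a z) = 0.
Proof.
move=> Cphi z0 crit k; apply: (Rmult_eq_reg_l (pi a z k)); last exact: pi_neq0.
rewrite Rmult_0_r.
apply: (skeleton_separates (c := fun k => pi a z k * pd phi k (pi a z))) => j.
by rewrite -pd_comp_pi // crit Rmult_0_r.
Qed.

End Skeleton.

Section Resolution.
Variables (n : nat) (U : vec n -> Prop) (f : vec n -> R) (a : 'I_n -> mindex n).
Hypotheses (oU : is_open U) (U0 : U (zero n)).
Implicit Types (x y z : vec n) (i j k : 'I_n) (al : mindex n) (I : pred 'I_n).

Variable al0 : mindex n.
Hypotheses (comp : completable (map a (enum 'I_n))) (sal0 : in_supp U f al0).
Hypothesis sf : smooth_on U f.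

Let lv : mindex n := fun j => dotn (a j) al0.

Hypothesis lv_min : forall j, lmin (Newton U f) (natv (a j)) (INR (lv j)).

Lemma lmin_weight I : lmin (Newton U f) (natv (weight a I)) (INR (level lv I)).
Proof.
split=> [|x Px].
  by exists (natv al0); rewrite dotR_natv dotn_weight; split; first exact: supp_Newton.
by rewrite /level INR_sum dotR_weight; apply: Rsum_le => j _; have [_] := lv_min j; apply.
Qed.

Lemma level_min I al : in_supp U f al -> (level lv I <= dotn (weight a I) al)%N.
Proof.
move=> sal; apply/leP/INR_le; rewrite -dotR_natv.
by have [_] := lmin_weight I; apply; exact: supp_Newton.
Qed.

Lemma full_face_vertex al : in_supp U f al ->
  dotn (weight a xpredT) al = level lv xpredT -> al = al0.
Proof.
move=> sal al_level.
have lv_le j : INR (lv j) <= dotR (natv (a j)) (natv al).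
  by have [_] := lv_min j; apply; exact: supp_Newton.
have lv_eq j : dotR (natv (a j)) (natv al) = INR (lv j).
  apply: (Rsum_le_eq lv_le).
  by rewrite -(dotR_weight a xpredT) dotR_natv al_level /level INR_sum.
apply: functional_extensionality => k; apply: INR_eq.
suff : natv al k + -1 * natv al0 k = 0 by rewrite /natv; lra.
apply: (skeleton_separates comp (c := fun k => natv al k + -1 * natv al0 k)) => j.
by rewrite dotRDZr lv_eq dotR_natv /lv; ring.
Qed.

Variable fs : vec n -> R.
Hypothesis sfs : smooth_on (fun y => U (pi a y)) fs.
Hypothesis fsE : forall y, U (pi a y) -> f (pi a y) = mono lv y * fs y.

Lemma factor_zero_neq0 : fs (zero n) <> 0.
Proof.
have w0 k : (0 < weight a xpredT k)%N.
  have [j ajk] := skeleton_positive comp k.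
  by rewrite lt0n; apply/eqP => wk; rewrite (weight_eq0 wk) in ajk.
pose one : vec n := fun _ => 1.
have mono_one al : mono al one = 1 by rewrite /mono big1 // => j _; exact: pow1.
have pi_one : pi a one = one.
  by apply: functional_extensionality => k; exact: (mono_one (a^~ k)).
have scale_one : scale xpredT 0 one = zero n.
  by apply: functional_extensionality => j; rewrite /scale Rmult_0_l.
have := face_poly_pi one oU U0 sf (sfs 0%N) fsE w0 (@level_min xpredT).
rewrite pi_one scale_one mono_one Rmult_1_l => <-.
rewrite (face_poly_vertex oU U0 sf _ w0 (dotn_weight a xpredT al0)); last exact: full_face_vertex.
by rewrite mono_one Rmult_1_r; apply/(in_suppE oU U0 _ sf).
Qed.

Lemma face_poly_critical I z : (forall k, (0 < weight a I k)%N) -> fs (scale I 0 z) = 0 ->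
  (forall j, ~~ I j -> has_partial fs j (scale I 0 z) 0) ->
  forall j, pd (fun x => face_poly f (weight a I) (level lv I) (pi a x)) j z = 0.
Proof.
move=> w0 fs0 crit j.
have -> : (fun x => face_poly f (weight a I) (level lv I) (pi a x)) =
    fun x => mono lv x * fs (scale I 0 x).
  apply: functional_extensionality => x.
  exact: face_poly_pi oU U0 sf (sfs 0%N) fsE w0 (@level_min I).
apply: has_partial_unique.
have Dmono := Ck1_has_partial j (@is_open_true n) (Ck_mono 1 _ lv) (x := z) Logic.I.
have Dfs : has_partial (fun x => fs (scale I 0 x)) j z 0.
  by apply: has_partial_scale0; exact: crit.
by have := has_partial_mult Dmono Dfs; rewrite fs0 !Rmult_0_r Rplus_0_r.
Qed.

Lemma factor_grad_nonzero I y : nondegenerate U f -> T_I I y -> pi a y = zero n ->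
  fs y = 0 -> grad_nonzero fs (fun j => ~~ I j) y.
Proof.
move=> nd TIy piy fsy crit.
have w0 k : (0 < weight a I k)%N by apply: stratum_weight_gt0 TIy _; rewrite piy.
have Uy : U (pi a y) by rewrite piy.
have [z [z0 [zy Uz]]] := stratum_torus_lift oU TIy Uy.
rewrite -zy in fsy crit.
pose phi := face_poly f (weight a I) (level lv I).
have phiE : phi = poly_of (face_list f (weight a I) (level lv I)).
  by apply: functional_extensionality => x; rewrite poly_of_face_list.
have Cphi : Ck 1 (fun _ => True) phi by rewrite phiE; exact: Ck_poly_of.
have phi_crit := pi_critical comp Cphi z0 (face_poly_critical w0 fsy crit).
have face_compact := lmin_compact_face w0 (lmin_weight I).
have face_part := gamma_part_face_list oU U0 sf (level lv I) w0.
apply: (nd _ face_compact _ face_part _ Uz) => [k|k _]; first exact: pi_neq0.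
rewrite -phiE -(phi_crit k).
exact: Ck1_has_partial (@is_open_true n) Cphi Logic.I.
Qed.

End Resolution.

Theorem theorem8p10 (n : nat) (U : vec n -> Prop) (f : vec n -> R)
    (Sig : list (mindex n) -> Prop) (a : 'I_n -> mindex n) :
  is_open U -> U (zero n) -> hatE U f -> (exists x, Newton U f x) ->
  simplicial_subdivision (Newton U f) Sig -> Sig (map a (enum 'I_n)) ->
  exists lv : 'I_n -> nat,
    (forall j, lmin (Newton U f) (natv (a j)) (INR (lv j))) /\
    exists fs : vec n -> R,
      smooth_on (fun y => U (pi a y)) fs /\ fs (zero n) <> 0 /\
      (forall y, U (pi a y) ->
         f (pi a y) = (\big[Rmult/1]_(j < n) (y j ^ lv j)) * fs y) /\
      (nondegenerate U f ->
       forall I : 'I_n -> bool,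
         (forall x, (exists y, T_I I y /\ pi a y = x) <-> x = zero n) ->
         forall y, T_I I y -> U (pi a y) -> fs y = 0 ->
           grad_nonzero fs (fun j => ~~ I j) y).
Proof.
move=> oU U0 fh _ sub Siga; have [sf _] := fh.
have comp : completable (map a (enum 'I_n)) by case: sub => _ [_]; apply.
have [al0 [sal0 cone_min]] := subdivision_vertex sub Siga.
pose lv j := dotn (a j) al0.
have lv_min j : lmin (Newton U f) (natv (a j)) (INR (lv j)).
  by rewrite -dotR_natv; exact/cone_min/skeleton_in_cone.
have [fs [sfs fsE]] := smooth_factor oU fh lv_min.
exists lv; split=> //; exists fs; split=> //.
split; first exact: factor_zero_neq0 comp sal0 sf lv_min _ sfs fsE.
split=> // nd I stratum0 y TIy _.
have piy : pi a y = zero n by apply/stratum0; exists y.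
exact: (factor_grad_nonzero oU U0 comp sal0 sf lv_min sfs fsE nd TIy piy).
Qed.
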